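(* Let $k$ be an algebraically closed field, $A$ a connected finite-dimensional hereditary $k$-algebra, $T$ a preprojective tilting $A$-module with $B=\operatorname{End}_A(T)$, and $M$ an indecomposable $A$-module. Then the supports of the $B$-modules $F(M)=\operatorname{Ext}^1_A(T,M)$ and $G(M)=\operatorname{Hom}_A(T,M)$ are disjoint.
   Context: Modules are finite-dimensional left modules; homomorphisms are written on the side opposite to scalars, so $T$ is an $A$-$B$-bimodule and $G(M)$, $F(M)$ are left $B$-modules. The support of a $B$-module $N$ is the set of isomorphism classes of simple $B$-modules occurring as composition factors of $N$. If $T_1,\dots,T_n$ are the indecomposable direct summands of $T$, one from each isomorphism class, the simple $B$-modules are indexed by $1,\dots,n$ (the $i$-th one being the top of the projective $B$-module $\operatorname{Hom}_A(T,T_i)$); the support of $G(M)$ is $\{i\mid\operatorname{Hom}_A(T_i,M)\ne0\}$ and the support of $F(M)$ is $\{i\mid\operatorname{Ext}^1_A(T_i,M)\neq0\}$. An $A$-module is preprojective if each indecomposable direct summand is of the form $\tau^{-m}P$ with $P$ indecomposable projective, $m\ge0$ ($\tau$ the Auslander–Reiten translation). *)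

(* Defs.v *)
From HB Require Import structures.
From mathcomp Require Import all_boot all_algebra all_field.
From mathcomp Require Import boolp classical_sets functions.

Set Implicit Arguments.
Unset Strict Implicit.
Unset Printing Implicit Defensive.

Import GRing.Theory.
Local Open Scope ring_scope.

Definition onto (X Y : Type) (f : X -> Y) : Prop := forall y, exists x, f x = y.

Section Homs.
Variable R : pzRingType.

Definition ModHom (U V : lmodType R) : Type := {linear U -> V}.
HB.instance Definition _ (U V : lmodType R) := gen_eqMixin (ModHom U V).
HB.instance Definition _ (U V : lmodType R) := gen_choiceMixin (ModHom U V).

Lemma ModHomP (U V : lmodType R) (f g : ModHom U V) :
  (forall x, f x = g x) -> f = g.
Proof.
case: f g => f [[fa] [fl]] [g [[ga] [gl]]] /= /funext fg.
by subst g; congr (GRing.Linear.Pack (GRing.Linear.Class _ _));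
  congr (_ _); exact: Prop_irrelevance.
Qed.

Section Zmod.
Variables U V : lmodType R.
Definition hom0 : ModHom U V := \0 : {linear U -> V}.
Definition homD (f g : ModHom U V) : ModHom U V := f \+ g : {linear U -> V}.
Definition homN (f : ModHom U V) : ModHom U V := \- f : {linear U -> V}.
Fact homDA : associative homD.
Proof. by move=> f g h; apply: ModHomP => x /=; rewrite addrA. Qed.
Fact homDC : commutative homD.
Proof. by move=> f g; apply: ModHomP => x /=; rewrite addrC. Qed.
Fact hom0D : left_id hom0 homD.
Proof. by move=> f; apply: ModHomP => x /=; rewrite add0r. Qed.
Fact homND : left_inverse hom0 homN homD.
Proof. by move=> f; apply: ModHomP => x /=; rewrite addNr. Qed.
HB.instance Definition _ :=
  GRing.isZmodule.Build (ModHom U V) homDA homDC hom0D homND.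
End Zmod.

(* Endomorphisms are written on the right: the product b * b' is
   "first b, then b'". *)
Definition hom_id (U : lmodType R) : ModHom U U := idfun : {linear U -> U}.
Definition hom_then (U V W : lmodType R) (f : ModHom U V)
    (g : ModHom V W) : ModHom U W := g \o f : {linear U -> W}.

Definition ModEnd (T : lmodType R) : Type := ModHom T T.
HB.instance Definition _ (T : lmodType R) := GRing.Zmodule.on (ModEnd T).

Section EndRing.
Variable T : lmodType R.
Fact endMA : associative (@hom_then T T T).
Proof. by move=> f g h; apply: ModHomP. Qed.
Fact end1M : left_id (hom_id T) (@hom_then T T T).
Proof. by move=> f; apply: ModHomP. Qed.
Fact endM1 : right_id (hom_id T) (@hom_then T T T).
Proof. by move=> f; apply: ModHomP. Qed.
Fact endDM : left_distributive (@hom_then T T T) (@homD T T).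
Proof. by move=> f g h; apply: ModHomP => x /=; rewrite linearD. Qed.
Fact endMD : right_distributive (@hom_then T T T) (@homD T T).
Proof. by move=> f g h; apply: ModHomP. Qed.
HB.instance Definition _ := GRing.Zmodule_isPzRing.Build (ModEnd T)
  endMA end1M endM1 endDM endMD.
End EndRing.

(* Hom(T, M) is a left module over End(T): (b f)(t) = f (t b). *)
Section HomModule.
Variables T M : lmodType R.
Fact homZA (b b' : ModEnd T) (f : ModHom T M) :
  hom_then b (hom_then b' f) = hom_then (b * b') f.
Proof. exact: ModHomP. Qed.
Fact hom1Z : left_id (1 : ModEnd T) (@hom_then T T M).
Proof. by move=> f; apply: ModHomP. Qed.
Fact homZDr : right_distributive (@hom_then T T M) +%R.
Proof. by move=> b f g; apply: ModHomP. Qed.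
Fact homZDl (f : ModHom T M) : {morph (@hom_then T T M)^~ f : b b' / b + b'}.
Proof. by move=> b b'; apply: ModHomP => x /=; rewrite linearD. Qed.
HB.instance Definition _ := GRing.Zmodule_isLmodule.Build (ModEnd T) (ModHom T M)
  homZA hom1Z homZDr homZDl.
End HomModule.

End Homs.

Section Modules.
Variable R : pzRingType.
Implicit Types X Y Z M P S : lmodType R.

Definition zero_module X : Prop := forall x : X, x = 0.

Definition mod_iso X Y : Prop := exists f : ModHom X Y, bijective f.

Definition direct_summand X M : Prop := exists Y, mod_iso M (X * Y)%type.

Definition indecomposable M : Prop :=
  ~ zero_module M /\
  forall X Y, mod_iso M (X * Y)%type -> zero_module X \/ zero_module Y.

Definition projective_module P : Prop :=
  forall X Y (g : ModHom X Y) (f : ModHom P Y), onto g ->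
    exists h : ModHom P X, forall p, g (h p) = f p.

Definition short_exact X Y Z (i : ModHom X Y) (p : ModHom Y Z) : Prop :=
  [/\ injective i, onto p & forall y, p y = 0 <-> exists x, i x = y].

Definition essential_epi X Y (f : ModHom X Y) : Prop :=
  onto f /\ forall Z (g : ModHom Z X), onto (f \o g) -> onto g.

Definition projective_cover P X (p : ModHom P X) : Prop :=
  projective_module P /\ essential_epi p.

Definition minimal_presentation P1 P0 X (p1 : ModHom P1 P0) (p0 : ModHom P0 X)
  : Prop :=
  projective_cover p0 /\
  exists K (i : ModHom K P0) (q : ModHom P1 K),
    [/\ short_exact i p0, projective_cover q & forall u, p1 u = i (q u)].

Definition is_submodule M (K : set M) : Prop :=
  K 0 /\ forall (a : R) x y, K x -> K y -> K (a *: x + y).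

Definition simple_module S : Prop :=
  ~ zero_module S /\
  forall K : set S, is_submodule K -> K = [set 0]%classic \/ K = setT.

(* K / L is isomorphic to S; the values of f outside K are irrelevant. *)
Definition subquotient_iso M (K L : set M) S : Prop :=
  exists f : M -> S,
    [/\ forall (a : R) x y, K x -> K y -> f (a *: x + y) = a *: f x + f y,
        forall s, exists2 x, K x & f x = s
      & forall x, K x -> (f x = 0 <-> L x)].

Definition composition_series M (l : nat) (C : nat -> set M) : Prop :=
  [/\ C 0 = [set 0]%classic, C l = setT,
      forall i, (i <= l)%N -> is_submodule (C i)
    & forall i, (i < l)%N -> (C i `<=` C i.+1)%classic /\
        exists2 S, simple_module S & subquotient_iso (C i.+1) (C i) S].

Definition composition_factor M S : Prop :=
  exists (l : nat) (C : nat -> set M), composition_series l C /\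
    exists2 i, (i < l)%N & subquotient_iso (C i.+1) (C i) S.

Definition in_support M S : Prop := simple_module S /\ composition_factor M S.

Definition disjoint_supports M N : Prop :=
  forall S, ~ (in_support M S /\ in_support N S).

End Modules.

Section Restriction.
Variables (k : fieldType) (A : falgType k) (M : lmodType A).

Definition restrict : Type := M.
HB.instance Definition _ := GRing.Zmodule.on restrict.
Definition res_scale (c : k) (x : restrict) : restrict := c%:A *: (x : M).
Fact res_scaleA c d x : res_scale c (res_scale d x) = res_scale (c * d) x.
Proof. by rewrite /res_scale scalerA -scalerAl mul1r scalerA. Qed.
Fact res_scale1 : left_id 1 res_scale.
Proof. by move=> x; rewrite /res_scale !scale1r. Qed.
Fact res_scaleDr : right_distributive res_scale +%R.
Proof. by move=> c x y; rewrite /res_scale scalerDr. Qed.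
Fact res_scaleDl x : {morph res_scale^~ x : c d / c + d}.
Proof. by move=> c d; rewrite /res_scale !scalerDl. Qed.
HB.instance Definition _ := GRing.Zmodule_isLmodule.Build k restrict
  res_scaleA res_scale1 res_scaleDr res_scaleDl.

Definition fin_dim : Prop :=
  exists (n : nat) (e : 'I_n -> restrict),
    forall x : restrict, exists c : 'I_n -> k, x = \sum_i c i *: e i.
End Restriction.

Section Algebra.
Variables (k : fieldType) (A : falgType k).
Implicit Types (M X Y Z P T : lmodType A).

Definition mod_act M (a : A) (x : restrict M) : restrict M := a *: (x : M).
Fact act_linear M (a : A) : linear (@mod_act M a).
Proof.
move=> c x y; rewrite /mod_act scalerDr; congr (_ + _).
by rewrite scalerA [RHS]scalerA -scalerAl mul1r -scalerAr mulr1.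
Qed.
HB.instance Definition _ M (a : A) :=
  GRing.isLinear.Build k (restrict M) (restrict M) *:%R (@mod_act M a) (@act_linear M a).

Definition res_hom X Y (f : ModHom X Y) (x : restrict X) : restrict Y := f x.
Fact res_hom_linear X Y (f : ModHom X Y) : linear (res_hom f).
Proof. by move=> c x y; apply: linearP. Qed.
HB.instance Definition _ X Y (f : ModHom X Y) :=
  GRing.isLinear.Build k (restrict X) (restrict Y) *:%R (res_hom f) (res_hom_linear f).

(* D M = Hom_k(M, k) is a right module: (f a)(m) = f (a m). *)
Section Dual.
Variable M : lmodType A.
Definition Dual : Type := ModHom (restrict M) k^o.
HB.instance Definition _ := GRing.Zmodule.on Dual.
Definition dual_scale (a : A^c) (f : Dual) : Dual :=
  f \o @mod_act M a : {linear restrict M -> k^o}.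
Fact dual_scaleA a b f :
  dual_scale a (dual_scale b f) = dual_scale (a * b) f.
Proof. by apply: ModHomP => x /=; rewrite /mod_act scalerA. Qed.
Fact dual_scale1 : left_id 1 dual_scale.
Proof. by move=> f; apply: ModHomP => x /=; rewrite /mod_act scale1r. Qed.
Fact dual_scaleDr : right_distributive dual_scale +%R.
Proof. by move=> a f g; apply: ModHomP. Qed.
Fact dual_scaleDl f : {morph dual_scale^~ f : a b / a + b}.
Proof. by move=> a b; apply: ModHomP => x /=; rewrite /mod_act scalerDl linearD. Qed.
HB.instance Definition _ := GRing.Zmodule_isLmodule.Build A^c Dual
  dual_scaleA dual_scale1 dual_scaleDr dual_scaleDl.
End Dual.

(* The A-dual Hom_A(P, A) of a right module P is a left module:
   (a f)(p) = a (f p). *)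
Section Star.
Variable P : lmodType A^c.
Definition Star : Type := ModHom P (A^c)^o.
HB.instance Definition _ := GRing.Zmodule.on Star.
Definition lmul (a : A) (x : (A^c)^o) : (A^c)^o := a * (x : A).
Fact lmul_linear a : linear (lmul a).
Proof. by move=> r x y; rewrite /lmul mulrDr; congr (_ + _); apply: (@mulrA A a x r). Qed.
HB.instance Definition _ a :=
  GRing.isLinear.Build A^c (A^c)^o (A^c)^o *:%R (lmul a) (lmul_linear a).
Definition star_scale (a : A) (f : Star) : Star :=
  lmul a \o f : {linear P -> (A^c)^o}.
Fact star_scaleA a b f :
  star_scale a (star_scale b f) = star_scale (a * b) f.
Proof. by apply: ModHomP => x /=; apply: (@mulrA A). Qed.
Fact star_scale1 : left_id 1 star_scale.
Proof. by move=> f; apply: ModHomP => x /=; apply: (@mul1r A). Qed.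
Fact star_scaleDr : right_distributive star_scale +%R.
Proof. by move=> a f g; apply: ModHomP => x /=; apply: (@mulrDr A). Qed.
Fact star_scaleDl f : {morph star_scale^~ f : a b / a + b}.
Proof. by move=> a b; apply: ModHomP => x /=; apply: (@mulrDl A). Qed.
HB.instance Definition _ := GRing.Zmodule_isLmodule.Build A Star
  star_scaleA star_scale1 star_scaleDr star_scaleDl.
End Star.

(* Ext^1_A(X, Y), computed from the bar resolution of X (projective because
   k is a field): since Hom_A(A (x) V, Y) = Hom_k(V, Y), the 1-cochains are
   the k-bilinear maps d : A x X -> Y, the cocycles are those with
   d(ab, x) = a d(b, x) + d(a, b x), and the coboundaries are the maps
   (a, x) |-> a h(x) - h(a x) with h : X -> Y k-linear.  Equivalently, d
   encodes the extension Y (+) X with a (y, x) = (a y + d(a, x), a x). *)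
Section Ext.
Variables X Y : lmodType A.

Definition cocycle (d : A -> X -> Y) : Prop :=
  [/\ forall a, linear (d a : restrict X -> restrict Y),
      forall x, linear (fun a => d a x : restrict Y)
    & forall a b x, d (a * b) x = a *: d b x + d a (b *: x)].

Definition coboundary (d : A -> X -> Y) : Prop :=
  exists h : ModHom (restrict X) (restrict Y),
    forall a x, d a x = a *: (h x : Y) - h (a *: x).

Definition Z1 : {pred A -> X -> Y} := [pred d | `[< cocycle d >]].
Fact Z1_zmod : zmod_closed Z1.
Proof.
split=> [|d e /asboolP[dX dA dM] /asboolP[eX eA eM]]; apply/asboolP; split.
- by move=> a c x y; rewrite /= [RHS]addr0 scaler0.
- by move=> x c a b; rewrite /= [RHS]addr0 scaler0.
- by move=> a b x; rewrite [RHS]addr0 scaler0.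
- move=> a c x y; rewrite -![(d - e) a _]/(d a _ - e a _).
  by rewrite [d a _]dX [e a _]eX scalerBr opprD addrACA.
- move=> x c a b; rewrite -![(d - e) _ x]/(d _ x - e _ x).
  by rewrite [d _ x]dA [e _ x]eA scalerBr opprD addrACA.
- move=> a b x; rewrite -![(d - e) _ _]/(d _ _ - e _ _).
  by rewrite dM eM scalerBr opprD addrACA.
Qed.
HB.instance Definition _ := GRing.isZmodClosed.Build (A -> X -> Y) Z1 Z1_zmod.

Definition Cocycle : Type := {d : A -> X -> Y | d \in Z1}.
HB.instance Definition _ := SubChoice.on Cocycle.
HB.instance Definition _ := [SubChoice_isSubZmodule of Cocycle by <:].

Definition B1 : {pred Cocycle} := [pred d | `[< coboundary (val d) >]].
Fact B1_zmod : zmod_closed B1.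
Proof.
split=> [|d e /asboolP[g dg] /asboolP[h eh]]; apply/asboolP.
  by exists 0 => a x; rewrite /= scaler0 subr0.
exists (g - h) => a x.
rewrite [LHS]/(val d a x - val e a x) dg eh scalerBr !opprB.
by rewrite addrACA [LHS]addrACA; congr (_ + _); rewrite addrC.
Qed.
HB.instance Definition _ := GRing.isZmodClosed.Build Cocycle B1 B1_zmod.

Definition Ext1 : Type := Quotient.quot B1.
HB.instance Definition _ := GRing.Zmodule.on Ext1.

(* End(X) acts by (b d)(a, x) = d(a, x b). *)
Definition precomp (b : ModEnd X) (d : A -> X -> Y) : A -> X -> Y :=
  fun a x => d a (b x).
Fact precomp_Z1 b (d : Cocycle) : precomp b (val d) \in Z1.
Proof.
have /asboolP[dX dA dM] := valP d; apply/asboolP; split.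
- move=> a c x y; rewrite /precomp -dX; congr (val d a _).
  by rewrite [LHS]linearD [b (c *: x)]linearZ.
- by move=> x c a a'; apply: dA.
- by move=> a a' x; rewrite /precomp dM linearZ.
Qed.
Definition cocycle_act b (d : Cocycle) : Cocycle := Sub (precomp b (val d)) (precomp_Z1 b d).
Fact cocycle_act_zmod b : zmod_morphism (cocycle_act b).
Proof. by move=> d e; apply: val_inj. Qed.
HB.instance Definition _ b :=
  GRing.isZmodMorphism.Build Cocycle Cocycle (cocycle_act b)
    (cocycle_act_zmod b).
Fact cocycle_act_B1 b d : d \in B1 -> cocycle_act b d \in B1.
Proof.
move=> /asboolP[h dh]; apply/asboolP.
exists (h \o res_hom b : {linear restrict X -> restrict Y}) => a x.
by rewrite /= /precomp dh /res_hom linearZ.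
Qed.

Local Open Scope quotient_scope.
Definition ext_class (d : Cocycle) : Ext1 := \pi_(Quotient.quot B1) d.
Definition ext_scale (b : ModEnd X) (e : Ext1) : Ext1 :=
  ext_class (cocycle_act b (repr (e : Quotient.quot B1))).

Fact ext_classP d e : reflect (ext_class d = ext_class e) (d - e \in B1).
Proof. by rewrite Quotient.idealrBE; apply: eqP. Qed.
Fact ext_classD d e : ext_class (d + e) = ext_class d + ext_class e.
Proof. exact: (raddfD \pi_(Quotient.quot B1)). Qed.
Fact ext_classK e : ext_class (repr (e : Quotient.quot B1)) = e.
Proof. exact: reprK. Qed.
Lemma ext_scaleE b d : ext_scale b (ext_class d) = ext_class (cocycle_act b d).
Proof.
by apply/ext_classP; rewrite -raddfB cocycle_act_B1 //; apply/ext_classP;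
  rewrite ext_classK.
Qed.
Fact ext_scaleA b b' e : ext_scale b (ext_scale b' e) = ext_scale (b * b') e.
Proof.
rewrite -[e]ext_classK !ext_scaleE; congr ext_class; exact: val_inj.
Qed.
Fact ext_scale1 : left_id 1 ext_scale.
Proof.
by move=> e; rewrite -[e]ext_classK ext_scaleE; congr ext_class; apply: val_inj.
Qed.
Fact ext_scaleDr : right_distributive ext_scale +%R.
Proof.
move=> b e f; rewrite -[e]ext_classK -[f]ext_classK -ext_classD !ext_scaleE.
by rewrite raddfD ext_classD.
Qed.
Fact ext_scaleDl e : {morph ext_scale^~ e : b b' / b + b'}.
Proof.
move=> b b'; rewrite -[e]ext_classK !ext_scaleE -ext_classD; congr ext_class.
apply: val_inj; apply/funext => a; apply/funext => x.
have /asboolP[dX _ _] := valP (repr (e : Quotient.quot B1)).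
by have := dX a 1 (b x) (b' x); rewrite !scale1r.
Qed.
HB.instance Definition _ := GRing.Zmodule_isLmodule.Build (ModEnd X) Ext1
  ext_scaleA ext_scale1 ext_scaleDr ext_scaleDl.
End Ext.

(* A is nonzero, being a falgType, and is not a product of two nonzero
   algebras. *)
Definition connected_algebra : Prop :=
  forall (A1 A2 : falgType k) (f : {lrmorphism A -> (A1 * A2)%type}),
    ~ bijective f.

Definition hereditary_algebra : Prop :=
  forall (P X : lmodType A) (i : ModHom X P),
    fin_dim P -> projective_module P -> injective i -> projective_module X.

(* X is isomorphic to tau^-1 Y = Tr D Y, where Tr N is the cokernel of
   Hom_A(p1, A) for a minimal projective presentation p1 : P1 -> P0 of N.
   When Y is finite-dimensional, so are P1 and P0, by minimality. *)
Definition is_tau_inv Y X : Prop :=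
  exists (P1 P0 : lmodType A^c) (p1 : ModHom P1 P0) (p0 : ModHom P0 (Dual Y)),
    minimal_presentation p1 p0 /\
    exists q : ModHom (Star P1) X, onto q /\
      forall u : Star P1, q u = 0 <-> exists v : Star P0, u = hom_then p1 v.

(* X is isomorphic to tau^-m Y. *)
Fixpoint is_tau_inv_iter (m : nat) Y X : Prop :=
  if m is m'.+1 then exists Z, is_tau_inv_iter m' Y Z /\ is_tau_inv Z X
  else mod_iso Y X.

Definition preprojective_module M : Prop :=
  forall X, direct_summand X M -> indecomposable X ->
    exists (P : lmodType A) (m : nat),
      [/\ fin_dim P, projective_module P, indecomposable P & is_tau_inv_iter m P X].

Definition proj_dim_le1 M : Prop :=
  exists (P1 P0 : lmodType A) (i : ModHom P1 P0) (p : ModHom P0 M),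
    [/\ fin_dim P0, projective_module P1, projective_module P0 & short_exact i p].

Definition in_add T X : Prop := exists n, direct_summand X {ffun 'I_n -> T}.

Definition tilting_module T : Prop :=
  [/\ proj_dim_le1 T, zero_module (Ext1 T T)
    & exists (T0 T1 : lmodType A) (i : ModHom A^o T0) (p : ModHom T0 T1),
        [/\ in_add T T0, in_add T T1 & short_exact i p]].
End Algebra.

(* Main.v *)
Require Import Defs.
From HB Require Import structures.
From mathcomp Require Import all_boot all_algebra all_field.
From mathcomp Require Import boolp classical_sets functions.
Import Defs.

(** If [X = tau^-m P] with [P] indecomposable projective and [M] is
    indecomposable, then [Hom(X, M)] and [Ext^1(X, M)] are not both nonzero: for
    [m = 0] the second group vanishes, and for [m > 0] a nonzero [Hom(X, M)]
    forces [M] to be non-projective, so that the pair [(X, M)] may be replaced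
    by [(tau X, tau M)].  A simple [End(T)]-module in both supports is acted on
    nontrivially by the idempotent of some indecomposable summand [X] of [T],
    for which both groups are then nonzero.

    The translation step is carried out on projective presentations.  With
    [P1 -> P0 -> DZ] a presentation of the dual of [Z = tau X] and [Q1 -> Q0 -> M]
    a resolution of [M], homomorphisms and extensions from [X] to [M] lift to
    maps between [P1^* ] and [P0^* ] and [Q0], [Q1]; transposing these gives
    homomorphisms and extensions from [Tr M] to [DZ], hence from [Z] to
    [tau M = D Tr M]. *)

Set Implicit Arguments.
Unset Strict Implicit.
Unset Printing Implicit Defensive.

Import GRing.Theory.
Local Open Scope ring_scope.

(** * Modules over a ring *)

Section Modules.
Variable R : pzRingType.
Implicit Types U V W X Y M P : lmodType R.

Definition lin_hom U V (f : U -> V) (lf : linear f) : ModHom U V :=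
  HB.pack_for {linear U -> V} f (GRing.isLinear.Build R U V *:%R f lf).

Definition pointwise_lift U V W (g : U -> W) (f : V -> W) :=
  forall v, exists u, g u = f v.

(* The proof [hK] is a phantom argument, from which the module structure of
   [submod hK] is inferred. *)
Definition submod_pred M (K : set M) (hK : is_submodule K) : {pred M} :=
  [pred x | `[< K x >]].

Section Submodule.
Variables (M : lmodType R) (K : set M) (hK : is_submodule K).
Local Notation submod_pred := (submod_pred hK).
Fact submod_pred_closed : submod_closed submod_pred.
Proof.
case: hK => K0 KD; split; first exact/asboolP.
by move=> a x y /asboolP Kx /asboolP Ky; apply/asboolP/KD.
Qed.
HB.instance Definition _ :=
  GRing.isSubmodClosed.Build R M submod_pred submod_pred_closed.
Definition submod : Type := {x : M | x \in submod_pred}.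
HB.instance Definition _ := SubChoice.on submod.
HB.instance Definition _ := [SubChoice_isSubLmodule of submod by <:].

(** Locked so that simplification does not expose [val]; afterwards the map is handled through its
    injectivity and its range. *)
Definition submod_incl : ModHom (submod : lmodType R) M :=
  locked ((val : submod -> M) : {linear submod -> M}).

Lemma submod_inclE x : submod_incl x = val x.
Proof. by rewrite /submod_incl -lock. Qed.

Lemma submod_incl_inj : injective submod_incl.
Proof. by move=> x y; rewrite !submod_inclE; apply: val_inj. Qed.

Lemma submod_inclP x : K (submod_incl x).
Proof. by rewrite submod_inclE; apply/asboolP/(valP x). Qed.

Lemma submod_incl_onto x : K x -> exists y, submod_incl y = x.
Proof.
move=> /asboolP Kx; exists (Sub x Kx : submod); rewrite submod_inclE; apply: SubK.
Qed.
End Submodule.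

Lemma ker_submodule U V (f : ModHom U V) : is_submodule [set x | f x = 0].
Proof.
split=> [|a x y fx fy] /=; first exact: linear0.
by rewrite linearP fx fy scaler0 addr0.
Qed.

Lemma image_submodule U V (f : ModHom U V) : is_submodule (range f).
Proof.
split=> [|a _ _ [x _ <-] [y _ <-]]; first by exists 0 => //; apply: linear0.
by exists (a *: x + y) => //; apply: linearP.
Qed.

(** Two preimages of a point differ by an element of the kernel of [q], where [f] vanishes; so [f]
    composed with any section of [q] is linear. *)
Lemma factor_onto U V W (q : ModHom U V) (f : ModHom U W) :
  onto q -> (forall u, q u = 0 -> f u = 0) ->
  exists h : ModHom V W, forall u, h (q u) = f u.
Proof.
move=> qO qf; have [s sP] := choice qO.
have E u v : q u = q v -> f u = f v.
  move=> quv; apply/subr0_eq; rewrite -linearB.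
  by apply: qf; rewrite linearB quv subrr.
have lh : linear (fun v => f (s v)).
  by move=> a x y; rewrite -linearP; apply: E; rewrite linearP !sP.
by exists (lin_hom lh) => u; apply: E; rewrite sP.
Qed.

Lemma factor_inj U V W (i : ModHom U V) (f : ModHom W V) :
  injective i -> pointwise_lift i f ->
  exists h : ModHom W U, forall w, i (h w) = f w.
Proof.
move=> iI fi; have [s sP] := choice fi.
have lh : linear s by move=> a x y; apply: iI; rewrite linearP !sP linearP.
by exists (lin_hom lh) => u; rewrite sP.
Qed.

Lemma homBE U V (f g : ModHom U V) x : (f - g) x = f x - g x.
Proof. by []. Qed.

Lemma split_summand X M (i : ModHom X M) (p : ModHom M X) :
  (forall x, p (i x) = x) ->
  mod_iso M (X * submod (ker_submodule p))%type.
Proof.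
move=> pi; pose L : lmodType R := submod (ker_submodule p).
have [h hP] : exists h : ModHom M L,
    forall x, submod_incl (ker_submodule p) (h x) = (hom_id M - hom_then p i) x.
  apply: factor_inj => [|x]; first exact: submod_incl_inj.
  by apply: submod_incl_onto; rewrite homBE /= linearB pi subrr.
have lf : linear (fun x => (p x, h x)).
  by move=> a x y; rewrite !linearP.
exists (lin_hom lf); exists (fun y => i y.1 + submod_incl (ker_submodule p) y.2).
  by move=> x; rewrite /= hP homBE addrCA subrr addr0.
move=> [x y] /=; have py := submod_inclP y.
congr (_, _); first by rewrite linearD pi py addr0.
apply: submod_incl_inj; rewrite hP homBE /= linearD pi.
by rewrite [p _]py addr0 addrC addKr.
Qed.

(** [M] is the direct sum of the range of [e], realised as the kernel of [1 - e], and a complement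
    on which [e] vanishes. *)
Lemma indecomposable_idempotent M (e : ModHom M M) : indecomposable M ->
  (forall x, e (e x) = e x) -> (forall x, e x = 0) \/ (forall x, e x = x).
Proof.
move=> [_ indM] ee.
pose L : lmodType R := submod (ker_submodule (hom_id M - e)).
pose i : ModHom L M := submod_incl (ker_submodule (hom_id M - e)).
have iP x : e (i x) = i x.
  by apply/esym/subr0_eq; apply: (submod_inclP x).
have [p pP] : exists p : ModHom M L, forall x, i (p x) = e x.
  apply: factor_inj => [|x]; first exact: submod_incl_inj.
  by apply: submod_incl_onto; rewrite /mkset homBE /= ee subrr.
have pi x : p (i x) = x by apply: submod_incl_inj; rewrite pP iP.
case: (indM _ _ (split_summand pi)) => [Z|Z]; [left|right] => x.
  by rewrite -pP (Z (p x)) linear0.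
have [y yP] : exists y, submod_incl (ker_submodule p) y = x - e x.
  apply: submod_incl_onto => /=; apply: submod_incl_inj.
  by rewrite [LHS]pP linearB ee subrr [RHS]linear0.
by apply/esym/subr0_eq; rewrite -yP (Z y) linear0.
Qed.

Lemma idempotent_indecomposable M : ~ zero_module M ->
  (forall e : ModHom M M, (forall x, e (e x) = e x) ->
    (forall x, e x = 0) \/ (forall x, e x = x)) ->
  indecomposable M.
Proof.
move=> M0 idemM; split=> // X Y [f [g fK gK]].
have lg : linear g.
  by move=> a x y; apply: (can_inj fK); rewrite linearP !gK.
have le : linear (fun x => lin_hom lg ((f x).1, 0)).
  move=> a x y; rewrite [f _]linearP.
  transitivity (lin_hom lg (a *: ((f x).1, 0) + ((f y).1, 0))).
    by congr (lin_hom lg (_, _)); rewrite /= scaler0 addr0.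
  exact: linearP.
have ee x : lin_hom le (lin_hom le x) = lin_hom le x by rewrite /= gK.
case: (idemM _ ee) => H; [left|right] => x.
  have /= := H (g (x, 0)); rewrite gK => /(congr1 f).
  by rewrite gK linear0 => -[].
have /= := H (g (0, x)); rewrite gK => /(congr1 f).
by rewrite !gK => -[].
Qed.

(** If [b] annihilated [H], it would annihilate every subquotient of [H]. *)
Lemma composition_factor_act (H S : lmodType R) (b : R) (s : S) :
  composition_factor H S -> b *: s <> 0 -> exists x : H, b *: x <> 0.
Proof.
move=> [l [C [[_ _ Csub _] [i il [f [fL fO _]]]]]] bs.
have [K0 KD] := Csub _ il; have [x Kx fx] := fO s.
have f0 : f 0 = 0.
  have := fL 1 0 0 K0 K0; rewrite !scale1r addr0 => /esym/eqP.
  by rewrite -subr_eq0 addrK => /eqP.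
exists x => bx; apply: bs.
by have := fL b x 0 Kx K0; rewrite addr0 bx f0 fx addr0.
Qed.

Definition spanned M n : Prop :=
  exists e : 'I_n -> M, forall x, exists c : 'I_n -> R, x = \sum_i c i *: e i.

Lemma spanned_fin M (I : finType) (e : I -> M) :
  (forall x, exists c : I -> R, x = \sum_i c i *: e i) -> spanned M #|I|.
Proof.
move=> eP; exists (fun i => e (enum_val i)) => x; have [c ->] := eP x.
exists (fun i => c (enum_val i)); exact: (reindex _ (onW_bij _ (@enum_val_bij I))).
Qed.

Lemma free_hom_linear M n (y : 'I_n -> M) :
  linear (fun a : {ffun 'I_n -> R^o} => \sum_i (a i : R) *: y i).
Proof.
move=> c a b; rewrite scaler_sumr -big_split; apply: eq_bigr => i _ /=.
by rewrite !ffunE scalerA -scalerDl.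
Qed.

Definition free_hom M n (y : 'I_n -> M) : ModHom {ffun 'I_n -> R^o} M :=
  lin_hom (free_hom_linear y).

Lemma regular_projective : projective_module (R^o : lmodType R).
Proof.
move=> X Y g f gO; have [x gx] := gO (f 1).
have lh : linear (fun r : R^o => (r : R) *: x).
  by move=> a u v; rewrite scalerDl scalerA.
by exists (lin_hom lh) => r; rewrite linearZ gx -linearZ /= [_ *: _]mulr1.
Qed.

Lemma spanned_free n : spanned ({ffun 'I_n -> R^o} : lmodType R) n.
Proof.
exists (fun i => [ffun j => (i == j)%:R]) => x; exists x; apply/ffunP => j.
rewrite sum_ffunE (bigD1 j) //= !ffunE eqxx [_ *: _]mulr1.
by rewrite big1 ?addr0 // => i /negPf ij; rewrite !ffunE ij [_ *: _]mulr0.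
Qed.

Lemma free_projective n : projective_module ({ffun 'I_n -> R^o} : lmodType R).
Proof.
move=> X Y g f gO; have [s sP] := choice gO.
have [e eP] := spanned_free n.
exists (free_hom (fun i => s (f [ffun j => (i == j)%:R]))) => a /=.
rewrite linear_sum; under eq_bigr do rewrite linearZ sP -linearZ.
rewrite -linear_sum; congr (f _); apply/ffunP => j.
rewrite sum_ffunE (bigD1 j) //= !ffunE eqxx [_ *: _]mulr1.
by rewrite big1 ?addr0 // => i /negPf ij; rewrite !ffunE ij [_ *: _]mulr0.
Qed.

Lemma hom_sumE M X n (f : 'I_n -> ModHom M X) x : (\sum_i f i) x = \sum_i f i x.
Proof. by apply: (big_morph (fun g : ModHom M X => g x)). Qed.

(** The free cover given by generators [y] has a section; its coordinates are the functionals
    [x i]. *)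
Lemma projective_dual_basis M n : projective_module M -> spanned M n ->
  exists (y : 'I_n -> M) (x : 'I_n -> ModHom M R^o),
    forall m, m = \sum_i (x i m : R) *: y i.
Proof.
move=> projM [y yP].
have yO : onto (free_hom y).
  by move=> m; have [c ->] := yP m; exists [ffun i => c i];
    apply: eq_bigr => i _; rewrite ffunE.
have [s sP] := projM _ _ (free_hom y) (hom_id M) yO.
have xL i : linear (fun m => s m i) by move=> a u v; rewrite linearP !ffunE.
by exists y, (fun i => lin_hom (xL i)) => m; rewrite -[LHS](sP m).
Qed.

(** The free module on lifts of the generators of [X] maps onto [X], hence onto [P] because [p] is
    essential. *)
Lemma projective_cover_spanned P X (p : ModHom P X) n :
  projective_cover p -> spanned X n -> spanned P n.
Proof.
move=> [_ [pO pE]] [y yP]; have [s sP] := choice pO.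
have : onto (free_hom (fun i => s (y i))).
  apply: pE => x; have [c ->] := yP x; exists [ffun i => c i] => /=.
  by rewrite linear_sum; apply: eq_bigr => i _; rewrite linearZ ffunE /= sP.
move=> fO; exists (fun i => s (y i)) => u.
by have [a <-] := fO u; exists a.
Qed.

End Modules.

(** * Finite-dimensional vector spaces *)

Section LinearAlgebra.
Variables (k : fieldType) (W : lmodType k).
Implicit Types (J : set W).

(** Generators of [W / J], without forming the quotient. *)
Definition spans_mod J n (c : 'I_n -> W) : Prop :=
  forall w, exists a : 'I_n -> k, J (w - \sum_i a i *: c i).

Lemma spans_mod_drop J n (c : 'I_n.+1 -> W) (a : 'I_n.+1 -> k) (l : 'I_n.+1) :
  is_submodule J -> spans_mod J c -> J (\sum_i a i *: c i) -> a l != 0 ->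
  spans_mod J (fun i => c (lift l i)).
Proof.
move=> [J0 JD] cS aJ al w; have [b bJ] := cS w.
(* Subtracting [b l / a l] times the relation removes the generator [c l]. *)
exists (fun i => b (lift l i) - b l / a l * a (lift l i)).
have := JD (b l / a l) _ _ aJ bJ; congr J.
rewrite addrCA; congr (_ + _); rewrite (bigD1_ord l) //= [in X in _ - X](bigD1_ord l) //=.
rewrite scalerDr scalerA divfK // opprD addrACA subrr add0r.
rewrite scaler_sumr -!sumrN -big_split; apply: eq_bigr => i _ /=.
by rewrite scalerBl opprB scalerA.
Qed.

(** A generating family of [W / J] of minimal size is independent, so coefficients modulo [J] are
    unique; hence they are linear and vanish on [J]. *)
Lemma dual_basis_mod J n (e : 'I_n -> W) :
  is_submodule J -> spans_mod J e ->
  exists (m : nat) (c : 'I_m -> W) (f : 'I_m -> ModHom W k^o),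
    (forall w, J (w - \sum_i f i w *: c i)) /\ (forall i w, J w -> f i w = 0).
Proof.
move=> Jsub eS; have [J0 JD] := Jsub.
have JN x : J x -> J (- x) by move=> Jx; rewrite -scaleN1r -[_ *: _]addr0; apply: JD.
have exm : exists m, `[< exists c : 'I_m -> W, spans_mod J c >].
  by exists n; apply/asboolP; exists e.
case: (ex_minnP exm) => m /asboolP[c cS] mmin.
have uniq0 (a : 'I_m -> k) : J (\sum_i a i *: c i) -> forall i, a i = 0.
  move=> aJ l; apply/eqP/negP => /negP al.
  case: m c cS mmin a aJ l al => [|m] c cS mmin a aJ l al; first by case: l al.
  have := mmin m; rewrite ltnn => H; apply/notF/H/asboolP.
  by eexists; apply: spans_mod_drop al.
have [f fP] := choice cS.
have fL i : linear (fun w => f w i : k^o).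
  move=> a x y; apply/eqP; rewrite -subr_eq0; apply/eqP.
  apply: (uniq0 (fun i => f (a *: x + y) i - (a * f x i + f y i))) => {i}.
  have := JD 1 _ _ (JN _ (fP (a *: x + y))) (JD a _ _ (fP x) (fP y)).
  congr J; rewrite scale1r opprB scalerBr [X in _ + X]addrACA [LHS]addrA subrK.
  rewrite scaler_sumr -!sumrN -!big_split; apply: eq_bigr => i _ /=.
  by rewrite scalerBl scalerDl scalerA opprD.
exists m, c, (fun i => lin_hom (fL i)); split=> //= i w Jw.
apply: uniq0; have := JD (-1) _ _ (fP w) Jw.
by rewrite scaleN1r opprB subrK.
Qed.

Lemma zero_submodule : is_submodule [set (0 : W)].
Proof. by split=> // a _ _ -> ->; rewrite scaler0 addr0. Qed.

Lemma spanned_spans_mod J n : is_submodule J -> spanned W n ->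
  exists e : 'I_n -> W, spans_mod J e.
Proof.
by move=> [J0 _] [e eP]; exists e => w; have [a ->] := eP w; exists a; rewrite subrr.
Qed.

Lemma spanned_dual_basis n : spanned W n ->
  exists (m : nat) (c : 'I_m -> W) (f : 'I_m -> ModHom W k^o),
    forall w, w = \sum_i f i w *: c i.
Proof.
move=> /(spanned_spans_mod zero_submodule)[e eS].
have [m [c [f [fc _]]]] := dual_basis_mod zero_submodule eS.
by exists m, c, f => w; apply/subr0_eq/fc.
Qed.

End LinearAlgebra.

Section LinearMaps.
Variables (k : fieldType).
Implicit Types (V W : lmodType k).

Lemma spanned_onto V W (f : ModHom V W) n : onto f -> spanned V n -> spanned W n.
Proof.
move=> fO [e eP]; exists (fun i => f (e i)) => w.
have [v <-] := fO w; have [c ->] := eP v; exists c.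
by rewrite linear_sum; apply: eq_bigr => i _; rewrite linearZ.
Qed.

Lemma spanned_onto_drop V W (f : ModHom V W) n v :
  onto f -> spanned V n.+1 -> v <> 0 -> f v = 0 -> spanned W n.
Proof.
move=> fO VS v0 fv; have Jsub := ker_submodule f.
have [e eP] := VS; have [a av] := eP v.
have [l al] : exists l, a l != 0.
  apply/not_existsP => a0; apply: v0; rewrite av big1 // => i _.
  by have /negP := a0 i; rewrite negbK => /eqP ->; rewrite scale0r.
have eS : spans_mod [set x | f x = 0] e.
  by move=> w; have [b ->] := eP w; exists b => /=; rewrite subrr linear0.
have aJ : f (\sum_i a i *: e i) = 0 by rewrite -av.
have dS := spans_mod_drop Jsub eS aJ al.
exists (fun i => f (e (lift l i))) => w; have [u <-] := fO w.
have [c /= cP] := dS u; exists c; apply/subr0_eq; rewrite -[RHS]cP linearB; congr (_ - _).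
by rewrite linear_sum; apply: eq_bigr => i _; rewrite linearZ.
Qed.

Lemma spanned_inj V W (f : ModHom V W) n : injective f -> spanned W n ->
  exists r : ModHom W V, forall x, r (f x) = x.
Proof.
move=> fI /(spanned_spans_mod (image_submodule f))[e eS].
have [m [c [g [gc g0]]]] := dual_basis_mod (image_submodule f) eS.
(* The linear projection onto the range of [f] along the [c i]. *)
have lh : linear (fun w => w - \sum_i g i w *: c i).
  move=> a x y; rewrite scalerBr addrACA; congr (_ + _).
  rewrite scaler_sumr -!sumrN -big_split; apply: eq_bigr => i _ /=.
  by rewrite linearP scalerDl scalerA opprD.
have [r rP] : exists r : ModHom W V, forall x, f (r x) = lin_hom lh x.
  by apply: factor_inj => // w; have [x _ fx] := gc w; exists x.
exists r => x; apply: fI; rewrite rP /= big1 ?subr0 // => i _.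
by rewrite g0 ?scale0r //; exists x.
Qed.

End LinearMaps.

(** * Dualities *)

Section RightRestriction.
Variables (k : fieldType) (A : falgType k) (P : lmodType A^c).

Definition rrestrict : Type := P.
HB.instance Definition _ := GRing.Zmodule.on rrestrict.
Definition rres_scale (c : k) (x : rrestrict) : rrestrict :=
  (c%:A : A^c) *: (x : P).
Fact rres_scaleA c d x : rres_scale c (rres_scale d x) = rres_scale (c * d) x.
Proof.
rewrite /rres_scale scalerA; congr (_ *: _).
by rewrite [LHS](mulr_algl d (c%:A : A)) scalerA mulrC.
Qed.
Fact rres_scale1 : left_id 1 rres_scale.
Proof. by move=> x; rewrite /rres_scale scale1r; apply: scale1r. Qed.
Fact rres_scaleDr : right_distributive rres_scale +%R.
Proof. by move=> c x y; rewrite /rres_scale scalerDr. Qed.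
Fact rres_scaleDl x : {morph rres_scale^~ x : c d / c + d}.
Proof. by move=> c d; rewrite /rres_scale scalerDl; apply: scalerDl. Qed.
HB.instance Definition _ := GRing.Zmodule_isLmodule.Build k rrestrict
  rres_scaleA rres_scale1 rres_scaleDr rres_scaleDl.
End RightRestriction.

Section Pairing.
Variables (k : fieldType) (A : falgType k).
Implicit Types (Q X Y M : lmodType A) (P : lmodType A^c).

Lemma rres_linear P P' (f : ModHom P P') :
  linear (f : rrestrict P -> rrestrict P').
Proof. by move=> c x y; apply: (linearP f). Qed.

Lemma res_linear Q Q' (f : ModHom Q Q') :
  linear (f : restrict Q -> restrict Q').
Proof. by move=> c x y; apply: (linearP f). Qed.

(* [b] identifies the left module [Q] with the dual of the right module [P]
   and conversely, both being finitely generated projective. *)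
Definition perfect_pairing Q P (b : Q -> P -> A) : Prop :=
  [/\ forall a x y p, b (a *: x + y) p = a * b x p + b y p,
      forall q (a : A) x y, b q ((a : A^c) *: x + y) = b q x * a + b q y
    & exists (m : nat) (x : 'I_m -> P) (y : 'I_m -> Q),
        (forall q, q = \sum_i b q (x i) *: y i) /\
        (forall p, p = \sum_i (b (y i) p : A^c) *: x i)].

Section PairingFacts.
Variables (Q : lmodType A) (P : lmodType A^c) (b : Q -> P -> A).
Hypothesis bP : perfect_pairing b.

Lemma pairing_linearl p : linear (fun q => b q p : A^o).
Proof. by move=> a x y; have [bl _ _] := bP; apply: bl. Qed.

Lemma pairing_linearr q : linear (fun p => b q p : (A^c)^o).
Proof. by move=> a x y; have [_ br _] := bP; apply: br. Qed.

Lemma pairingNr q p : b q (- p) = - b q p.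
Proof. exact: (linearN (lin_hom (pairing_linearr q))). Qed.
Lemma pairingNl q p : b (- q) p = - b q p.
Proof. exact: (linearN (lin_hom (pairing_linearl p))). Qed.
Lemma pairingDr q p p' : b q (p + p') = b q p + b q p'.
Proof. exact: (linearD (lin_hom (pairing_linearr q))). Qed.
Lemma pairingDl q q' p : b (q + q') p = b q p + b q' p.
Proof. exact: (linearD (lin_hom (pairing_linearl p))). Qed.
Lemma pairing0r q : b q 0 = 0.
Proof. exact: (linear0 (lin_hom (pairing_linearr q))). Qed.
Lemma pairing0l p : b 0 p = 0.
Proof. exact: (linear0 (lin_hom (pairing_linearl p))). Qed.
Lemma pairingZr q (a : A) p : b q ((a : A^c) *: p) = b q p * a.
Proof. by have [_ br _] := bP; rewrite -[_ *: p]addr0 br pairing0r addr0. Qed.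
Lemma pairingZl a q p : b (a *: q) p = a * b q p.
Proof. by have [bl _ _] := bP; rewrite -[_ *: q]addr0 bl pairing0l addr0. Qed.
Lemma pairing_sumr q m (p : 'I_m -> P) : b q (\sum_i p i) = \sum_i b q (p i).
Proof. exact: (big_morph _ (pairingDr q) (pairing0r q)). Qed.
Lemma pairing_suml m (q : 'I_m -> Q) p : b (\sum_i q i) p = \sum_i b (q i) p.
Proof. exact: (big_morph (b^~ p) (fun u v => pairingDl u v p) (pairing0l p)). Qed.

Lemma pairing_injl q q' : (forall p, b q p = b q' p) -> q = q'.
Proof.
have [_ _ [m [x [y [yP _]]]]] := bP => bqq'.
by rewrite (yP q) (yP q'); apply: eq_bigr => i _; rewrite bqq'.
Qed.

Lemma pairing_injr p p' : (forall q, b q p = b q p') -> p = p'.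
Proof.
have [_ _ [m [x [y [_ xP]]]]] := bP => bpp'.
by rewrite (xP p) (xP p'); apply: eq_bigr => i _; rewrite bpp'.
Qed.

(** Projectivity of [Q] from its dual basis: lift the values at the [y i] and extend with the
    coordinates [b q (x i)]. *)
Lemma pairing_liftl X Y (g : ModHom X Y) (f : ModHom Q Y) :
  pointwise_lift g f -> exists h : ModHom Q X, forall q, g (h q) = f q.
Proof.
move=> gf; have [s sP] := choice gf; have [_ _ [m [x [y [yP _]]]]] := bP.
have hL : linear (fun q => \sum_i b q (x i) *: s (y i)).
  move=> a u v; rewrite scaler_sumr -big_split; apply: eq_bigr => i _ /=.
  by rewrite [b _ _]pairing_linearl scalerDl scalerA.
exists (lin_hom hL) => q; rewrite [in RHS](yP q) !linear_sum.
by apply: eq_bigr => i _; rewrite !linearZ sP.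
Qed.

Lemma pairing_liftr (X Y : lmodType A^c) (g : ModHom X Y) (f : ModHom P Y) :
  pointwise_lift g f -> exists h : ModHom P X, forall p, g (h p) = f p.
Proof.
move=> gf; have [s sP] := choice gf; have [_ _ [m [x [y [_ xP]]]]] := bP.
have hL : linear (fun p => \sum_i (b (y i) p : A^c) *: s (x i)).
  move=> a u v; rewrite scaler_sumr -big_split; apply: eq_bigr => i _ /=.
  by rewrite [b _ _]pairing_linearr scalerDl scalerA.
exists (lin_hom hL) => p; rewrite [in RHS](xP p) !linear_sum.
by apply: eq_bigr => i _; rewrite !linearZ sP.
Qed.

Let E i := (vbasis {:A})`_i.
Let d := \dim {:A}.

Lemma alg_coord (a : A) : exists c : 'I_d -> k, a = \sum_i c i *: E i.
Proof. by exists (fun i => coord (vbasis {:A}) i a); apply/coord_vbasis/memvf. Qed.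

Lemma pairing_fdl : fin_dim Q.
Proof.
have [_ _ [m [x [y [yP _]]]]] := bP.
exists #|{: 'I_m * 'I_d}|; apply: (@spanned_fin _ (restrict Q) ('I_m * 'I_d)%type
  (fun ij => E ij.2 *: y ij.1)) => q.
have [c cP] := choice (fun i => alg_coord (b q (x i))).
exists (fun ij => c ij.1 ij.2).
rewrite [LHS](yP q) -(pair_big xpredT xpredT (fun i j => c i j *: (E j *: y i : restrict Q))) /=.
apply: eq_bigr => i _; rewrite {1}(cP i) scaler_suml; apply: eq_bigr => j _.
by rewrite [RHS]scalerA mulr_algl.
Qed.

Lemma pairing_fdr : exists n, spanned (rrestrict P) n.
Proof.
have [_ _ [m [x [y [_ xP]]]]] := bP.
exists #|{: 'I_m * 'I_d}|; apply: (@spanned_fin _ (rrestrict P) ('I_m * 'I_d)%type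
  (fun ij => (E ij.2 : A^c) *: x ij.1)) => p.
have [c cP] := choice (fun i => alg_coord (b (y i) p)).
exists (fun ij => c ij.1 ij.2).
rewrite [LHS](xP p) -(pair_big xpredT xpredT (fun i j => c i j *: ((E j : A^c) *: x i : rrestrict P))) /=.
apply: eq_bigr => i _; rewrite {1}(cP i).
rewrite (scaler_suml (x i) _ _ (fun j => c i j *: E j : A^c)); apply: eq_bigr => j _.
rewrite -[RHS]/(((c i j)%:A : A^c) *: ((E j : A^c) *: x i)) [RHS]scalerA.
apply: (congr1 (fun a : A^c => a *: x i)).
by rewrite -[LHS](mulr_algr (c i j) (E j : A)).
Qed.

End PairingFacts.

(** The transpose of [h]; evaluating the identity at the [y i] forces the formula for [h']. *)
Lemma pairing_adjoint Q P (b : Q -> P -> A) Q' P' (b' : Q' -> P' -> A)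
    (h : ModHom Q Q') :
  perfect_pairing b -> perfect_pairing b' ->
  exists h' : ModHom P' P, forall q p, b' (h q) p = b q (h' p).
Proof.
move=> bP bP'; have [_ _ [m [x [y [yP _]]]]] := bP.
have hL : linear (fun p => \sum_i (b' (h (y i)) p : A^c) *: x i).
  move=> a u v; rewrite scaler_sumr -big_split; apply: eq_bigr => i _ /=.
  by rewrite [b' _ _](pairing_linearr bP') scalerDl scalerA.
exists (lin_hom hL) => q p /=; rewrite [in LHS](yP q) linear_sum.
rewrite (pairing_suml bP') (pairing_sumr bP); apply: eq_bigr => i _.
by rewrite linearZ (pairingZl bP') (pairingZr bP).
Qed.

Lemma pairing_adjoint' Q P (b : Q -> P -> A) Q' P' (b' : Q' -> P' -> A)
    (h : ModHom P' P) :
  perfect_pairing b -> perfect_pairing b' ->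
  exists h' : ModHom Q Q', forall q p, b' (h' q) p = b q (h p).
Proof.
move=> bP bP'; have [_ _ [m [x [y [_ xP]]]]] := bP'.
have hL : linear (fun q => \sum_i b q (h (x i)) *: y i).
  move=> a u v; rewrite scaler_sumr -big_split; apply: eq_bigr => i _ /=.
  by rewrite [b _ _](pairing_linearl bP) scalerDl scalerA.
exists (lin_hom hL) => q p /=; rewrite [in RHS](xP p) linear_sum.
rewrite (pairing_suml bP') (pairing_sumr bP); apply: eq_bigr => i _.
by rewrite linearZ (pairingZl bP') (pairingZr bP).
Qed.

Lemma fin_dim_spanned M : fin_dim M -> exists n, spanned M n.
Proof.
move=> [n [e eP]]; exists n, e => x; have [c ->] := eP x.
by exists (fun i => (c i)%:A).
Qed.

Lemma rspanned P n : spanned (rrestrict P) n -> spanned P n.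
Proof.
move=> [e eP]; exists e => x; have [c ->] := eP x.
by exists (fun i => (c i)%:A : A).
Qed.

End Pairing.

Section LStar.
Variables (k : fieldType) (A : falgType k) (Q : lmodType A).

(** The counterpart of [Star] for left modules: a right module under [(f a)(q) = f(q) a]. *)
Definition LStar : Type := ModHom Q A^o.
HB.instance Definition _ := GRing.Zmodule.on LStar.
Fact lstar_linear (a : A^c) (f : LStar) : linear (fun q => (f q : A) * a : A^o).
Proof.
by move=> c x y; rewrite linearP mulrDl; congr (_ + _); rewrite -[LHS]mulrA.
Qed.
Definition lstar_scale (a : A^c) (f : LStar) : LStar := lin_hom (lstar_linear a f).
Fact lstar_scaleA a b f :
  lstar_scale a (lstar_scale b f) = lstar_scale (a * b) f.
Proof. by apply: ModHomP => x; apply/esym/(@mulrA A). Qed.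
Fact lstar_scale1 : left_id 1 lstar_scale.
Proof. by move=> f; apply: ModHomP => x; apply: (@mulr1 A). Qed.
Fact lstar_scaleDr : right_distributive lstar_scale +%R.
Proof. by move=> a f g; apply: ModHomP => x; apply: (@mulrDl A). Qed.
Fact lstar_scaleDl f : {morph lstar_scale^~ f : a b / a + b}.
Proof. by move=> a b; apply: ModHomP => x; apply: (@mulrDr A). Qed.
HB.instance Definition _ := GRing.Zmodule_isLmodule.Build A^c LStar
  lstar_scaleA lstar_scale1 lstar_scaleDr lstar_scaleDl.
End LStar.

Section ProjectivePairings.
Variables (k : fieldType) (A : falgType k).

(** Applying [u] to the dual basis expansion in [P] also expands [u] through its values on the
    generators, which gives both halves of perfectness. *)
Lemma star_pairing (P : lmodType A^c) n : projective_module P -> spanned P n ->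
  perfect_pairing (fun (u : Star P) (p : P) => u p : A).
Proof.
move=> projP spanP; have [y [x xP]] := projective_dual_basis projP spanP.
split=> [//|u a p p'|]; first exact: linearP.
exists n, y, x; split=> // u; apply: ModHomP => p.
rewrite hom_sumE [in LHS](xP p) linear_sum; apply: eq_bigr => i _.
by rewrite linearZ.
Qed.

Lemma lstar_pairing (Q : lmodType A) n : projective_module Q -> spanned Q n ->
  perfect_pairing (fun (q : Q) (f : LStar Q) => f q : A).
Proof.
move=> projQ spanQ; have [y [x xP]] := projective_dual_basis projQ spanQ.
split=> [a u v p|//|]; first exact: linearP.
exists n, x, y; split=> // f; apply: ModHomP => q.
rewrite hom_sumE [in LHS](xP q) linear_sum; apply: eq_bigr => i _.
by rewrite linearZ.
Qed.

Lemma free_pairing n : perfect_pairing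
  (fun (q : {ffun 'I_n -> A^o}) (f : LStar {ffun 'I_n -> A^o}) => f q : A).
Proof. exact: (lstar_pairing (@free_projective A n) (spanned_free A n)). Qed.

Lemma pairing_projective (Q : lmodType A) (P : lmodType A^c) (b : Q -> P -> A) :
  perfect_pairing b -> projective_module Q.
Proof.
by move=> bP X Y g f gO; apply: (pairing_liftl bP) => q; apply: gO.
Qed.

Lemma regular_fin_dim : fin_dim (A^o : lmodType A).
Proof.
have span1 : spanned (A^o : lmodType A) 1; last first.
  exact: (pairing_fdl (lstar_pairing (@regular_projective A) span1)).
by exists (fun=> 1) => x; exists (fun=> x); rewrite big_ord1 [_ *: _]mulr1.
Qed.

End ProjectivePairings.

(** * Extensions *)

Section Extensions.
Variables (k : fieldType) (A : falgType k).
Implicit Types (U V X Y Q K : lmodType A).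

(* The middle term of the extension encoded by a cocycle; [hd] is a phantom
   argument, as for [submod]. *)
Definition twisted X Y (d : A -> X -> Y) (hd : cocycle d) : Type := (Y * X)%type.

Section Twisted.
Variables (X Y : lmodType A) (d : A -> X -> Y) (hd : cocycle d).
Local Notation twisted := (twisted hd).
HB.instance Definition _ := GRing.Zmodule.on twisted.

Lemma cocycleDr a x y : d a (x + y) = d a x + d a y.
Proof. by have [dX _ _] := hd; have := dX a 1 x y; rewrite !scale1r. Qed.

Lemma cocycleDl a b x : d (a + b) x = d a x + d b x.
Proof. by have [_ dA _] := hd; have := dA x 1 a b; rewrite !scale1r. Qed.

Lemma cocycle1 x : d 1 x = 0.
Proof.
have [_ _ dM] := hd; have := dM 1 1 x; rewrite mulr1 !scale1r => /esym/eqP.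
by rewrite -subr_eq0 addrK => /eqP.
Qed.

(** Hence [k] acts componentwise on the twisted module, and both components of a homomorphism into
    it are [k]-linear. *)
Lemma cocycleC c x : d c%:A x = 0.
Proof.
have [_ dA _] := hd; have := dA x c 1 0.
rewrite cocycle1 scaler0 add0r addr0 => ->.
by have := cocycleDl 0 0 x; rewrite addr0 => /esym/eqP; rewrite -subr_eq0 addrK => /eqP.
Qed.

Definition twisted_scale (a : A) (u : twisted) : twisted :=
  (a *: u.1 + d a u.2, a *: u.2).
Fact twisted_scaleA a b u :
  twisted_scale a (twisted_scale b u) = twisted_scale (a * b) u.
Proof.
have [_ _ dM] := hd.
by rewrite /twisted_scale /= scalerDr !scalerA dM addrA.
Qed.
Fact twisted_scale1 : left_id 1 twisted_scale.
Proof. by case=> y x; rewrite /twisted_scale /= cocycle1 !scale1r addr0. Qed.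
Fact twisted_scaleDr : right_distributive twisted_scale +%R.
Proof.
move=> a u v; rewrite /twisted_scale.
by congr (_, _); rewrite /= ?cocycleDr !scalerDr // addrACA.
Qed.
Fact twisted_scaleDl u : {morph twisted_scale^~ u : a b / a + b}.
Proof.
move=> a b; rewrite /twisted_scale.
by congr (_, _); rewrite /= ?cocycleDl !scalerDl // addrACA.
Qed.
HB.instance Definition _ := GRing.Zmodule_isLmodule.Build A twisted
  twisted_scaleA twisted_scale1 twisted_scaleDr twisted_scaleDl.

Lemma twisted_proj_linear : linear (fun u : twisted => u.2).
Proof. by []. Qed.

(** [p] lifts to a homomorphism into the twisted module; [l] is its first component. *)
Lemma cocycle_lift Q (p : ModHom Q X) : projective_module Q ->
  exists l : ModHom (restrict Q) (restrict Y),
    forall a (q : Q), (l (a *: q) : Y) = a *: (l q : Y) + d a (p q).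
Proof.
move=> projQ.
have [|h hp] := projQ _ _ (lin_hom twisted_proj_linear) p.
  by move=> x; exists (0, x).
have lP a (q : Q) : (h (a *: q)).1 = a *: (h q).1 + d a (p q).
  by rewrite linearZ -hp.
have lL : linear (fun q : restrict Q => (h q).1 : restrict Y).
  move=> c x y; rewrite [h _]linearD /=; congr (_ + _).
  by rewrite [LHS]lP cocycleC addr0.
by exists (lin_hom lL).
Qed.

Lemma projective_coboundary : projective_module X -> coboundary d.
Proof.
move=> /(cocycle_lift (hom_id X))[l lP]; exists (- l) => a x.
rewrite -[(- l) _]/(- l x : Y) -[(- l) _]/(- l (a *: x) : Y) scalerN opprK.
by rewrite [l (a *: x)]lP addKr.
Qed.

(** Part of the long exact sequence of Hom(-, Y): as Ext^1(Q, Y) = 0, the class of [d] comes from a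
    map [w] on [K], and it vanishes if [w] extends to [Q]. *)
Lemma non_coboundary_non_extendable Q K (p : ModHom Q X) (i : ModHom K Q) :
  projective_module Q -> onto p ->
  (forall q, p q = 0 <-> exists x, i x = q) -> ~ coboundary d ->
  exists w : ModHom K Y, ~ exists g : ModHom Q Y, forall x, g (i x) = w x.
Proof.
move=> projQ pO ip dN; have [l lP] := cocycle_lift p projQ.
have pi x : p (i x) = 0 by apply/ip; exists x.
have d0 a : d a 0 = 0.
  by have := cocycleDr a 0 0; rewrite addr0 => /esym/eqP; rewrite -subr_eq0 addrK => /eqP.
have wL : linear (fun x => l (i x) : Y).
  move=> a x y; rewrite linearP [l _]linearD; congr (_ + _).
  by rewrite lP pi d0 addr0.
exists (lin_hom wL) => -[g gP]; apply: dN.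
(* [l - g] vanishes on the range of [i], so it descends to [h] on [X], and [d] is the coboundary of
   [- h]. *)
pose e : ModHom (restrict Q) (restrict Y) := l - lin_hom (res_linear g).
have [||h hP] := @factor_onto _ _ _ _ (lin_hom (res_linear p)) e.
- exact: pO.
- by move=> q /= /ip[x <-]; rewrite -[LHS]/((l (i x) : Y) - g (i x)) gP subrr.
have {}hP q : h (p q) = (l q : Y) - g q by apply: hP.
exists (- h) => a x; have [q <-] := pO x.
rewrite -[(- h) _]/(- h (p q)) -[(- h) _]/(- h (a *: p q)) -[a *: p q]linearZ !hP.
rewrite [g (a *: q)]linearZ scalerN scalerBr opprK opprB [RHS]addrC addrA subrK.
by rewrite [l _]lP addrAC subrr add0r.
Qed.

End Twisted.
End Extensions.

Section Hereditary.
Variables (k : fieldType) (A : falgType k).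
Hypothesis hher : hereditary_algebra A.
Implicit Types (U V : lmodType A).

(** The range of [f] is projective by heredity, so [f] splits onto it; [e] is an idempotent with the
    same kernel as [f]. *)
Lemma split_image U V (f : ModHom U V) : fin_dim V -> projective_module V ->
  exists e : ModHom U U,
    (forall x, f (e x) = f x) /\ (forall x, f x = 0 -> e x = 0).
Proof.
move=> fdV projV; pose I : lmodType A := submod (image_submodule f).
pose i : ModHom I V := submod_incl (image_submodule f).
have iI : injective i by apply: submod_incl_inj.
have projI : projective_module I by apply: hher iI.
have [|f' f'P] := @factor_inj _ _ _ _ i f iI.
  by move=> x; apply: submod_incl_onto; exists x.
have f'O : onto f'.
  move=> y; have [x _ xy] := submod_inclP y; exists x.
  by apply: iI; rewrite f'P xy.
have [s sP] := projI _ _ f' (hom_id I) f'O.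
exists (hom_then f' s); split=> x; first by rewrite -f'P [f' _]sP f'P.
by move=> fx; have /= -> : f' x = 0; [apply: iI; rewrite f'P linear0|apply: linear0].
Qed.

End Hereditary.

(** * Auslander-Reiten translation *)

Section RightDual.
Variables (k : fieldType) (A : falgType k) (P : lmodType A^c).

Definition RDual : Type := ModHom (rrestrict P) k^o.
HB.instance Definition _ := GRing.Zmodule.on RDual.
Fact rdual_linear (a : A) (f : RDual) :
  linear (fun x : rrestrict P => f ((a : A^c) *: (x : P)) : k^o).
Proof.
move=> c x y; rewrite -linearP; congr (f _).
rewrite scalerDr; congr (_ + _).
rewrite -[LHS]/((a : A^c) *: ((c%:A : A^c) *: (x : P))).
rewrite -[RHS]/((c%:A : A^c) *: ((a : A^c) *: (x : P))) !scalerA.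
apply: (congr1 (fun a : A^c => a *: (x : P))).
by rewrite -[LHS]/(c%:A * a) -[RHS]/(a * c%:A) mulr_algl mulr_algr.
Qed.
Definition rdual_scale (a : A) (f : RDual) : RDual := lin_hom (rdual_linear a f).
Fact rdual_scaleA a b f :
  rdual_scale a (rdual_scale b f) = rdual_scale (a * b) f.
Proof. by apply: ModHomP => x /=; rewrite scalerA. Qed.
Fact rdual_scale1 : left_id 1 rdual_scale.
Proof. by move=> f; apply: ModHomP => x /=; rewrite scale1r. Qed.
Fact rdual_scaleDr : right_distributive rdual_scale +%R.
Proof. by move=> a f g; apply: ModHomP. Qed.
Fact rdual_scaleDl f : {morph rdual_scale^~ f : a b / a + b}.
Proof.
move=> a b; apply: ModHomP => x /=; rewrite -[RHS]linearD; congr (f _).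
exact: (@scalerDl _ P).
Qed.
HB.instance Definition _ := GRing.Zmodule_isLmodule.Build A RDual
  rdual_scaleA rdual_scale1 rdual_scaleDr rdual_scaleDl.

Lemma rdualZ (a : A) (f : RDual) x : (a *: f) x = f ((a : A^c) *: (x : P)).
Proof. by []. Qed.

Lemma rdualC c (f : RDual) x : (c%:A *: f) x = c * f x.
Proof. exact: (linearZZ f c x). Qed.

Lemma rdual_appC c (f : RDual) (x : P) : f ((c%:A : A^c) *: x) = c * f x.
Proof. exact: (linearZZ f c x). Qed.

Lemma rdual_appD (f : RDual) (x y : P) : f (x + y) = f x + f y.
Proof. exact: (linearD f x y). Qed.

Lemma rdual_appB (f : RDual) (x y : P) : f (x - y) = f x - f y.
Proof. exact: (linearB f x y). Qed.

Lemma rdual_app_sum n (f : RDual) (x : 'I_n -> P) :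
  f (\sum_i x i : P) = \sum_i f (x i).
Proof. exact: (big_morph f (rdual_appD f) (linear0 f)). Qed.
End RightDual.

Section Duals.
Variables (k : fieldType) (A : falgType k).
Implicit Types (Z : lmodType A) (P : lmodType A^c).

Lemma dualC Z c (f : Dual Z) z : ((c%:A : A^c) *: f) z = c * f z.
Proof. exact: (linearZZ f c z). Qed.

(** Hom(P, DZ) and Hom(Z, DP) consist of the same balanced bilinear forms, with arguments
    exchanged. *)
Lemma flip_hom Z P (g : ModHom P (Dual Z)) :
  exists h : ModHom Z (RDual P), forall z x, h z x = g x z.
Proof.
have hL z : linear (fun x : rrestrict P => g x z : k^o).
  by move=> c x y; rewrite [g _]linearP -[LHS]/(_ z + _ z) dualC.
pose h : Z -> RDual P := fun z => lin_hom (hL z).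
have hlin : linear h.
  move=> a z t; apply: ModHomP => x.
  rewrite -[RHS]/(g ((a : A^c) *: (x : P)) z + g x t) [g (_ *: _)]linearZ.
  exact: (linearD (g x)).
by exists (lin_hom hlin).
Qed.

Lemma unflip_hom Z P (h : ModHom Z (RDual P)) :
  exists g : ModHom P (Dual Z), forall z x, g x z = h z x.
Proof.
have gL x : linear (fun z : restrict Z => h z x : k^o).
  by move=> c z t; rewrite [h _]linearP -[LHS]/(_ x + _ x) rdualC.
pose g : P -> Dual Z := fun x => lin_hom (gL x).
have glin : linear g.
  move=> a x y; apply: ModHomP => z.
  rewrite -[RHS]/(h ((a : A) *: (z : Z)) x + h z y) [h (_ *: _)]linearZ.
  exact: (linearD (h z)).
by exists (lin_hom glin).
Qed.

Lemma spanned_dual Z : fin_dim Z -> exists n, spanned (Dual Z) n.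
Proof.
move=> [n fdZ]; have [m [c [f fc]]] := spanned_dual_basis fdZ.
exists m, f => g; exists (fun i => (g (c i))%:A : A); apply: ModHomP => z.
rewrite hom_sumE [in LHS](fc z) linear_sum; apply: eq_bigr => i _.
by rewrite dualC linearZ [RHS]mulrC.
Qed.

Lemma rdual_fin_dim P n : spanned (rrestrict P) n -> fin_dim (RDual P).
Proof.
move=> fdP; have [m [c [f fc]]] := spanned_dual_basis fdP.
exists m, f => g; exists (fun i => g (c i)); apply: ModHomP => z.
rewrite hom_sumE [in LHS](fc z) linear_sum; apply: eq_bigr => i _.
by rewrite rdualC linearZ [RHS]mulrC.
Qed.

Lemma fin_dim_inj (U V : lmodType A) (i : ModHom U V) :
  injective i -> fin_dim V -> fin_dim U.
Proof.
move=> iI [n fdV].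
have [r rP] := @spanned_inj _ (restrict U) (restrict V) (lin_hom (res_linear i)) n iI fdV.
exists n; apply: spanned_onto (r : ModHom (restrict V) (restrict U)) _ _ fdV.
by move=> u; exists (i u); apply: rP.
Qed.

Lemma fin_dim_onto (U V : lmodType A) (f : ModHom U V) :
  onto f -> fin_dim U -> fin_dim V.
Proof.
move=> fO [n fdU]; exists n.
exact: (@spanned_onto _ (restrict U) (restrict V) (lin_hom (res_linear f)) n fO fdU).
Qed.

Lemma rspanned_inj P P' (i : ModHom P P') n :
  injective i -> spanned (rrestrict P') n -> spanned (rrestrict P) n.
Proof.
move=> iI fdP.
have [r rP] := @spanned_inj _ (rrestrict P) (rrestrict P') (lin_hom (rres_linear i)) n iI fdP.
apply: spanned_onto (r : ModHom (rrestrict P') (rrestrict P)) _ _ fdP.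
by move=> u; exists (i u); apply: rP.
Qed.

Lemma star_hom_linear P P' (f : ModHom P P') :
  linear (fun v : Star P' => hom_then f v : Star P).
Proof. by move=> a u v; apply: ModHomP. Qed.

Definition star_hom P P' (f : ModHom P P') : ModHom (Star P') (Star P) :=
  lin_hom (star_hom_linear f).

End Duals.

(** * Presentations of the inverse translate *)

Section TauPresentation.
Variables (k : fieldType) (A : falgType k).
Hypothesis hher : hereditary_algebra A.

Definition star_eval (P : lmodType A^c) (u : Star P) (p : P) : A := u p.

(** The data kept from [X = Tr D Z]; minimality of the presentation survives as [tau_inv_hom0], that
    is, Hom(X, A) = 0. *)
Record tau_presentation (Z X : lmodType A) (P1 P0 : lmodType A^c)
    (p1 : ModHom P1 P0) (p0 : ModHom P0 (Dual Z)) (q : ModHom (Star P1) X) : Prop :=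
  TauPresentation {
    tau_pairing1 : perfect_pairing (@star_eval P1);
    tau_pairing0 : perfect_pairing (@star_eval P0);
    tau_onto : onto p0;
    tau_exact : forall x, p0 x = 0 <-> exists u, p1 u = x;
    tau_inv_onto : onto q;
    tau_inv_exact : forall u, q u = 0 <-> exists v, star_hom p1 v = u;
    tau_inv_hom0 : forall (f : ModHom X A^o) x, f x = 0
  }.

Lemma is_tau_inv_presentation Z X : fin_dim Z -> is_tau_inv Z X ->
  exists (P1 P0 : lmodType A^c) (p1 : ModHom P1 P0) (p0 : ModHom P0 (Dual Z))
    (q : ModHom (Star P1) X), tau_presentation p1 p0 q.
Proof.
move=> fdZ [P1 [P0 [p1 [p0 [[cover0 [K [i [s [[iI p0O ip] cover1 p1E]]]]] [q [qO qE]]]]]]].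
have [n spanZ] := spanned_dual fdZ.
have span0 := projective_cover_spanned cover0 spanZ.
have bP0 : perfect_pairing (@star_eval P0) := star_pairing (proj1 cover0) span0.
have [m spanK] := pairing_fdr bP0.
have span1 := projective_cover_spanned cover1 (rspanned (rspanned_inj iI spanK)).
have bP1 : perfect_pairing (@star_eval P1) := star_pairing (proj1 cover1) span1.
have [_ [sO sE]] := cover1.
exists P1, P0, p1, p0, q; split=> //.
- move=> x; rewrite ip; split=> [[y <-]|[u <-]]; last by exists (s u); rewrite p1E.
  by have [u <-] := sO y; exists u; apply: p1E.
- by move=> u; rewrite qE; split=> -[v uv]; exists v; apply/esym/uv.
(* A nonzero map to [A] would split off a summand of [P1] killed by [p1]. *)
move=> f; suff fq0 u : f (q u) = 0 by move=> x; have [u <-] := qO x.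
have [e [fe ke]] := split_image hher (hom_then q f) (regular_fin_dim A) (@regular_projective A).
have [e' e'P] := pairing_adjoint e bP1 bP1.
have ee : forall u, e (e u) = e u.
  by move=> w; apply/subr0_eq; rewrite -linearB; apply: ke; rewrite linearB fe subrr.
(* For [v] in [Star P0], [v (p1 (e' x))] is the value at [x] of [e] applied to [v p1], and [e] kills
   [v p1] because [q] does. *)
have pe x : p1 (e' x) = 0.
  apply: (pairing_injr bP0) => v; rewrite (pairing0r bP0).
  rewrite -[LHS]/(star_eval (star_hom p1 v) (e' x)) -e'P.
  rewrite (ke (star_hom p1 v)) ?(pairing0l bP1) //.
  have qv : q (star_hom p1 v) = 0 by apply/qE; exists v.
  exact: etrans (congr1 f qv) (linear0 f).
(* [s] kills the range of [e'], so [s (1 - e')] is onto and, [s] being essential, so is [1 - e'];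
   this forces the idempotent [e'] to be zero. *)
have gO : onto (hom_id P1 - e').
  apply: sE => y; have [x <-] := sO y; exists x.
  rewrite -[LHS]/(s (x - e' x)) linearB.
  suff -> : s (e' x) = 0 by rewrite subr0.
  by apply: iI; rewrite -p1E pe linear0.
have e'0 x : e' x = 0.
  have [y <-] := gO x; apply: (pairing_injr bP1) => w.
  rewrite (pairing0r bP1) -e'P homBE (pairingDr bP1) (pairingNr bP1) -e'P ee.
  by rewrite subrr.
rewrite -[LHS]/(hom_then q f u) -fe.
suff -> : e u = 0 by rewrite linear0.
by apply: (pairing_injl bP1) => x; rewrite e'P e'0 (pairing0l bP1) (pairing0r bP1).
Qed.

End TauPresentation.

Section Connecting.
Variables (k : fieldType) (A : falgType k) (Z E N : lmodType A).
Variables (i : ModHom N E) (l : Z -> E).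
Hypothesis iI : injective i.
Hypothesis lC : forall c z, l (c%:A *: z) = c%:A *: l z.
Hypothesis lD : forall z t, l (z + t) = l z + l t.
Hypothesis lN : forall (a : A) (z : Z), exists x, i x = a *: l z - l (a *: z).

(* The connecting homomorphism of [0 -> N -> E -> E/N -> 0]: [l] is a k-linear
   lift of a homomorphism from [Z] to [E/N]. *)
Lemma connecting_cocycle : exists d : A -> Z -> N, cocycle d /\
  (coboundary d -> exists g : ModHom Z E, forall z, exists x, i x = l z - g z).
Proof.
have [d dP] : exists d : A -> Z -> N,
    forall a z, i (d a z) = a *: l z - l (a *: z).
  have [d0 d0P] := choice (fun az : A * Z => lN az.1 az.2).
  by exists (fun a z => d0 (a, z)) => a z; apply: (d0P (a, z)).
have swap (U : lmodType A) (a : A) (c : k) (x : U) :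
    a *: (c%:A *: x) = c%:A *: (a *: x).
  by rewrite !scalerA mulr_algl mulr_algr.
have dL a c (z t : Z) : d a (c%:A *: z + t) = c%:A *: d a z + d a t.
  apply: iI; rewrite linearP !dP scalerDr swap !lD !lC scalerDr swap.
  by rewrite scalerBr opprD addrACA.
have dR c a b (z : Z) : d (c *: a + b) z = c%:A *: d a z + d b z.
  apply: iI; rewrite linearP !dP -(mulr_algl c a).
  by rewrite !scalerDl lD -!scalerA lC scalerBr opprD addrACA.
exists d; split.
  split=> [a c z t|z c a b|a b z]; [exact: dL|exact: dR|].
  apply: iI; rewrite [RHS]linearD [i (a *: _)]linearZZ !dP scalerBr !scalerA.
  by rewrite addrA subrK.
move=> [h hP].
(* When [d] is the coboundary of [h], the corrected map [l - i h] is [A]-linear. *)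
have gA a (z : Z) : (l (a *: z) : E) - i (h (a *: z)) = a *: (l z - i (h z)).
  have H : a *: i (h z) - i (h (a *: z)) = a *: l z - l (a *: z).
    by rewrite -dP hP linearB [i (a *: _)]linearZZ.
  have -> : i (h (a *: z)) = a *: i (h z) - (a *: l z - l (a *: z)).
    by rewrite -H subKr.
  by rewrite scalerBr opprB addrA [l (a *: z) + _]addrC subrK.
have gL : linear (fun z : Z => l z - i (h z)).
  move=> a z t; rewrite -gA lD [h _](linearD h) (linearD i) opprD.
  by rewrite addrACA.
by exists (lin_hom gL) => z; exists (h z); rewrite /= opprB addrCA subrr addr0.
Qed.
End Connecting.

(** * The translate of [M] and its endomorphisms *)

Section TauTranslate.
Variables (k : fieldType) (A : falgType k).
Variables (M Q0 Q1 : lmodType A) (R0 R1 : lmodType A^c).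
Variables (b0 : Q0 -> R0 -> A) (b1 : Q1 -> R1 -> A).
Variables (i : ModHom Q1 Q0) (p : ModHom Q0 M) (j : ModHom R0 R1).
Hypotheses (bP0 : perfect_pairing b0) (bP1 : perfect_pairing b1).
Hypotheses (iI : injective i) (pO : onto p).
Hypothesis ip : forall x, p x = 0 <-> exists y, i y = x.
Hypothesis ij : forall y r, b0 (i y) r = b1 y (j r).
Hypothesis hom0 : forall (f : ModHom M A^o) x, f x = 0.

Let pi y : p (i y) = 0. Proof. by apply/ip; exists y. Qed.

(** If [j r = 0], the functional [b0(-, r)] vanishes on the range of [i], so it factors through [M]
    and is zero as Hom(M, A) = 0. *)
Lemma transpose_inj : injective j.
Proof.
suff j0 r : j r = 0 -> r = 0.
  by move=> r s rs; apply/subr0_eq/j0; rewrite linearB rs subrr.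
move=> jr; have [|f fP] := factor_onto (f := lin_hom (pairing_linearl bP0 r)) pO.
  by move=> x /ip[y <-] /=; rewrite ij jr (pairing0r bP1).
apply: (pairing_injr bP0) => x; rewrite (pairing0r bP0).
by rewrite -[LHS]fP hom0.
Qed.

Fact tau_submodule : is_submodule [set f : RDual R1 | forall r, f (j r) = 0].
Proof.
split=> [r|a f g f0 g0 r] //=.
rewrite -[LHS]/(f ((a : A^c) *: (j r : R1)) + g (j r)) g0 addr0.
by rewrite -(linearZZ j (a : A^c) r) f0.
Qed.

(* [tau M = D Tr M]: with [R0 = Q0^*] and [R1 = Q1^*], the transpose of [M] is
   the cokernel of [j]. *)
Definition tau : lmodType A := submod tau_submodule.
Definition tau_incl : ModHom tau (RDual R1) := submod_incl tau_submodule.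

Lemma tau_incl_inj : injective tau_incl.
Proof. exact: submod_incl_inj. Qed.

Lemma tau_incl_ker x r : tau_incl x (j r) = 0.
Proof. exact: (submod_inclP x). Qed.

Lemma tau_incl_onto (f : RDual R1) :
  (forall r, f (j r) = 0) -> exists x, tau_incl x = f.
Proof. exact: submod_incl_onto. Qed.

Lemma tau_fin_dim : fin_dim tau.
Proof.
have [n fdR] := pairing_fdr bP1.
exact: fin_dim_inj tau_incl_inj (rdual_fin_dim fdR).
Qed.

(** [tau] is the [k]-dual of [R1 / j R0]; the [c l] generate this quotient, with coordinate
    functionals [f l]. *)
Lemma tau_dual_basis : exists (m : nat) (c : 'I_m -> R1) (f : 'I_m -> tau),
  (forall r, exists s, r - \sum_l ((tau_incl (f l) r)%:A : A^c) *: c l = j s) /\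
  (forall x, x = \sum_l (tau_incl x (c l))%:A *: f l).
Proof.
have [n fdR] := pairing_fdr bP1.
pose jk : ModHom (rrestrict R0) (rrestrict R1) := lin_hom (rres_linear j).
have Jsub := image_submodule jk.
have [e eS] := spanned_spans_mod Jsub fdR.
have [m [c [f [fc f0]]]] := dual_basis_mod Jsub eS.
have [g gP] : exists g : 'I_m -> tau, forall l, tau_incl (g l) = f l.
  have fN l : exists x, tau_incl x = f l.
    by apply: tau_incl_onto => r; apply: f0; exists r.
  by have [g gP] := choice fN; exists g.
exists m, c, g; split=> [r|x].
  have [s _ sP] := fc r; exists s; rewrite [RHS]sP; congr (_ - _).
  by apply: eq_bigr => l _; rewrite gP.
apply: tau_incl_inj; rewrite linear_sum; apply: ModHomP => r.
rewrite hom_sumE; have [s _ sP] := fc r.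
have -> : tau_incl x r = tau_incl x (\sum_l f l r *: c l).
  by apply/subr0_eq; rewrite -linearB -sP; apply: tau_incl_ker.
rewrite linear_sum; apply: eq_bigr => l _.
by rewrite (linearZZ tau_incl) rdualC gP [LHS](linearZZ (tau_incl x)) [RHS]mulrC.
Qed.

Lemma tau_separates r : (forall x, tau_incl x r = 0) -> exists s, j s = r.
Proof.
move=> r0; have [m [c [f [fc _]]]] := tau_dual_basis.
have [s sP] := fc r; exists s; rewrite -sP big1 ?subr0 // => l _.
by rewrite r0 scale0r; apply: scale0r.
Qed.

(** The left side is a functional of [x] on the finite-dimensional dual of [R1 / j R0], hence
    evaluation at a point. *)
Lemma tau_reflexive (f : ModHom tau tau) r :
  exists s, forall x, tau_incl (f x) r = tau_incl x s.
Proof.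
have [m [c [g [_ gc]]]] := tau_dual_basis.
exists (\sum_l ((tau_incl (f (g l)) r)%:A : A^c) *: c l) => x.
rewrite [in LHS](gc x) (linear_sum f) (linear_sum tau_incl) hom_sumE rdual_app_sum.
apply: eq_bigr => l _; rewrite linearZZ (linearZZ tau_incl) rdualC.
by rewrite rdual_appC mulrC.
Qed.

(* Any two lifts of an endomorphism to the presentation are homotopic, so
   endomorphisms of [tau M] and of [M] determine each other. *)
Lemma tau_end_eq0 (e : ModHom tau tau) (f1 : ModHom R1 R1)
    (g1 : ModHom Q1 Q1) (g0 : ModHom Q0 Q0) :
  (forall x r, tau_incl (e x) r = tau_incl x (f1 r)) ->
  (forall y r, b1 (g1 y) r = b1 y (f1 r)) ->
  (forall y, g0 (i y) = i (g1 y)) ->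
  (forall y, p (g0 y) = 0) -> forall x, e x = 0.
Proof.
move=> ef gf1 gi pg x.
(* As [p g0 = 0], there is a homotopy [h] with [g0 = i h]; transposed, [f1 = j h'], and [tau]
   vanishes on the range of [j]. *)
have [|h hP] := @pairing_liftl _ _ _ _ _ bP0 _ _ i g0.
  by move=> y; apply/ip/pg.
have [h' h'P] := pairing_adjoint h bP0 bP1.
apply: tau_incl_inj; apply: ModHomP => r; rewrite linear0 ef.
suff -> : f1 r = j (h' r) by rewrite tau_incl_ker.
apply: (pairing_injr bP1) => y; rewrite -gf1 -ij -h'P.
by congr (b1 _ _); apply: iI; rewrite hP gi.
Qed.

(** The endomorphism of [R1 / j R0] dual to [e] lifts to the projective module [R1]; the lift
    preserves [j R0], so it restricts to [R0], and transposing gives endomorphisms of [Q1] and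
    [Q0]. *)
Lemma tau_end_lift (e : ModHom tau tau) :
  exists (f1 : ModHom R1 R1) (f0 : ModHom R0 R0)
    (g1 : ModHom Q1 Q1) (g0 : ModHom Q0 Q0),
  [/\ forall x r, tau_incl (e x) r = tau_incl x (f1 r),
      forall r, j (f0 r) = f1 (j r),
      forall y r, b1 (g1 y) r = b1 y (f1 r),
      forall y r, b0 (g0 y) r = b0 y (f0 r)
    & forall y, g0 (i y) = i (g1 y)].
Proof.
have [_ _ [m [x [y [_ xP]]]]] := bP1.
have [w wP] := choice (fun l => tau_reflexive e (x l)).
have fL : linear (fun r => \sum_l (b1 (y l) r : A^c) *: w l).
  move=> a u v; rewrite scaler_sumr -big_split; apply: eq_bigr => l _ /=.
  by rewrite [b1 _ _](pairing_linearr bP1) scalerDl scalerA.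
pose f1 : ModHom R1 R1 := lin_hom fL.
have ef t r : tau_incl (e t) r = tau_incl t (f1 r).
  rewrite [in LHS](xP r) !rdual_app_sum; apply: eq_bigr => l _.
  by rewrite -!rdualZ -(linearZZ tau_incl) -(linearZZ e) -(linearZZ tau_incl) wP.
have [|f0 f0P] := @factor_inj _ _ _ _ j (hom_then j f1) transpose_inj.
  by move=> r; apply: tau_separates => t; rewrite -ef tau_incl_ker.
have [g1 g1P] := pairing_adjoint' f1 bP1 bP1.
have [g0 g0P] := pairing_adjoint' f0 bP0 bP0.
exists f1, f0, g1, g0; split=> // t; apply: (pairing_injl bP0) => r.
by rewrite g0P ij f0P -g1P -ij.
Qed.

(** An idempotent [e] of [tau] induces an idempotent [eps] of [M], which is 0 or 1; [tau_end_eq0]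
    carries this back to [e]. *)
Lemma tau_indecomposable : indecomposable M -> ~ zero_module tau ->
  indecomposable tau.
Proof.
move=> indM tau0; apply: idempotent_indecomposable => // e ee.
have [f1 [f0 [g1 [g0 [ef jf gf1 gf0 gi]]]]] := tau_end_lift e.
have [|eps epsP] := factor_onto (f := hom_then g0 p) pO.
  by move=> _ /ip[y <-] /=; rewrite gi pi.
have eps2 x : eps (eps x) = eps x.
  have [y <-] := pO x; rewrite !epsP /=; apply/subr0_eq.
  (* [f1 f1 - f1] induces zero on [tau], so it factors as [j h]; transposed, [g0 g0 - g0 = i h'],
     which vanishes in [M]. *)
  have [|h hP] := @pairing_liftr _ _ _ _ _ bP1 _ _ j (hom_then f1 f1 - f1).
    move=> r; apply: tau_separates => t.
    by rewrite rdual_appB -!ef ee subrr.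
  have [h' h'P] := pairing_adjoint' h bP0 bP1.
  rewrite -linearB; apply/ip; exists (h' y); apply: (pairing_injl bP0) => r.
  rewrite ij h'P (pairingDl bP0) (pairingNl bP0) !gf0.
  rewrite -(pairingNr bP0) -(pairingDr bP0); congr (b0 _ _).
  by apply: transpose_inj; rewrite hP homBE /= linearB !jf.
case: (indecomposable_idempotent indM eps2) => H; [left|right].
  by apply: (tau_end_eq0 ef gf1 gi) => y; rewrite -[LHS]epsP H.
(* If [eps = 1], the complementary lifts induce zero on [M], so [1 - e] is zero. *)
have c0 := @tau_end_eq0 (hom_id tau - e) (hom_id R1 - f1) (hom_id Q1 - g1)
  (hom_id Q0 - g0).
move=> x; apply/esym/subr0_eq; apply: c0 => {x} [x r|y r|y|y]; rewrite !homBE /=.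
- by rewrite linearB rdual_appB -ef.
- by rewrite (pairingDl bP1) (pairingNl bP1) (pairingDr bP1) (pairingNr bP1) gf1.
- by rewrite linearB gi.
- by rewrite linearB -[p (g0 y)]epsP H subrr.
Qed.

(** * Passage from the pair [(X, M)] to the pair [(Z, tau)] *)

Section Translate.
Variables (Z X : lmodType A) (P1 P0 : lmodType A^c).
Variables (p1 : ModHom P1 P0) (p0 : ModHom P0 (Dual Z)) (q : ModHom (Star P1) X).
Hypothesis tauX : tau_presentation p1 p0 q.

Let bS1 := tau_pairing1 tauX.
Let bS0 := tau_pairing0 tauX.
Let p01 u : p0 (p1 u) = 0. Proof. by apply/(tau_exact tauX); exists u. Qed.

(** The lift of [u] to the presentations, transposed, induces a map from [Z] to [tau]; if that map
    were zero, the lift would be null-homotopic and [u] zero. *)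
Lemma hom_tau (u : ModHom X M) x : u x <> 0 ->
  exists (f : ModHom Z tau) z, f z <> 0.
Proof.
move=> ux.
have [|v0 v0P] := @pairing_liftl _ _ _ _ _ bS1 _ _ p (hom_then q u).
  by move=> t; apply: pO.
have [|v1 v1P] := @pairing_liftl _ _ _ _ _ bS0 _ _ i (hom_then (star_hom p1) v0).
  move=> t; apply/ip; rewrite [LHS]v0P /=.
  have -> : q (star_hom p1 t) = 0 by apply/(tau_inv_exact tauX); exists t.
  exact: linear0.
have [v1' v1'P] := pairing_adjoint v1 bS0 bP1.
have [v0' v0'P] := pairing_adjoint v0 bS1 bP0.
have p1v0 r : p1 (v0' r) = v1' (j r).
  apply: (pairing_injr bS0) => t; rewrite -v1'P -ij v1P.
  by rewrite -[LHS]/(star_eval (star_hom p1 t) (v0' r)) -v0'P.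
(* On the range of [j], [p0 v1'] equals [p0 p1 v0' = 0], so the flipped map lands in [tau]. *)
have [phi phiP] := flip_hom (hom_then v1' p0).
have [|f fP] := factor_inj (f := phi) tau_incl_inj.
  by move=> z; apply: tau_incl_onto => r; rewrite phiP /= -p1v0 p01.
exists f; apply/not_existsP => f0; apply: ux.
have {}f0 z : f z = 0 by apply: contrapT; apply: f0.
(* Now [p0 v1' = 0], so [v1' = p1 h]; the transpose [h'] is the homotopy. *)
have [|h hP] := @pairing_liftr _ _ _ _ _ bP1 _ _ p1 v1'.
  move=> r; apply/(tau_exact tauX); apply: ModHomP => z.
  by rewrite -[LHS]phiP -fP f0 linear0.
have [h' h'P] := pairing_adjoint' h bS1 bP1.
(* [v0 - i h'] descends to a map from [X] to [Q0], which is zero because Hom(X, A) = 0. *)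
have [|g gP] := factor_onto (f := v0 - hom_then h' i) (tau_inv_onto tauX).
  move=> _ /(tau_inv_exact tauX)[t <-] /=; apply/eqP.
  rewrite subr_eq0; apply/eqP; rewrite -[LHS]v1P; congr (i _).
  apply: (pairing_injl bP1) => r; rewrite v1'P h'P -hP.
  by [].
have g0 y : g y = 0.
  apply: (pairing_injl bP0) => r; rewrite (pairing0l bP0).
  exact: (tau_inv_hom0 tauX (hom_then g (lin_hom (pairing_linearl bP0 r)))).
have [t <-] := tau_inv_onto tauX x.
rewrite -[LHS]/(hom_then q u t) -v0P.
have /subr0_eq -> : v0 t - i (h' t) = 0 by rewrite -[LHS]gP g0.
exact: pi.
Qed.

(** The class of [d] comes from a map [w] on [Star P0] that does not extend to [Star P1]. Its lift
    to [Q0], transposed, gives a map from [Z] to [D R0], and the connecting homomorphism of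
    [0 -> tau -> D R1 -> D R0 -> 0] sends it to [d']. *)
Lemma ext_tau (d : A -> X -> M) : cocycle d -> ~ coboundary d ->
  exists d' : A -> Z -> tau, cocycle d' /\ ~ coboundary d'.
Proof.
move=> dZ dB.
have projS1 := pairing_projective bS1.
have [w wN] := non_coboundary_non_extendable dZ projS1 (tau_inv_onto tauX)
  (tau_inv_exact tauX) dB.
have [|w0 w0P] := @pairing_liftl _ _ _ _ _ bS0 _ _ p w.
  by move=> t; apply: pO.
have [w0' w0'P] := pairing_adjoint w0 bS0 bP0.
have [n fdR] := pairing_fdr bP1.
(* Composition with a [k]-linear retraction of [j] extends functionals from [R0] to [R1]. *)
have [rho rhoP] := @spanned_inj _ (rrestrict R0) (rrestrict R1)
  (lin_hom (rres_linear j)) n transpose_inj fdR.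
have [th thP] := flip_hom (hom_then w0' p0).
have lL (z : Z) : linear (fun r : rrestrict R1 => th z (rho r) : k^o).
  by move=> c r s; rewrite [rho _]linearP [LHS]linearP.
have [|||d' [d'Z d'B]] := @connecting_cocycle _ _ _ _ _ tau_incl
  (fun z => lin_hom (lL z)) tau_incl_inj.
- move=> c z; apply: ModHomP => r.
  by rewrite rdualC -[LHS]/(th (c%:A *: z) (rho r)) [th _]linearZ rdualC.
- move=> z t; apply: ModHomP => r.
  by rewrite -[LHS]/(th (z + t) (rho r)) [th _]linearD.
- move=> a z; apply: tau_incl_onto => r.
  rewrite -[LHS]/(th z (rho ((a : A^c) *: (j r : R1))) - th (a *: z) (rho (j r))).
  rewrite -[X in rho X]linearZ !rhoP [th (_ *: _)]linearZ.
  exact: subrr.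
exists d'; split=> // /d'B[g gP]; apply: wN.
have [g' g'P] := unflip_hom g.
have [|g0 g0P] := @pairing_liftr _ _ _ _ _ bP1 _ _ p0 g'.
  by move=> r; apply: tau_onto tauX _.
(* If [d'] is a coboundary, the map from [Z] lifts to [D R1], so [w0'] and [g0 j] agree after [p0].
   Transposing the factor [e] writes [w0] as [i g1] plus [e1] after [star_hom p1], so [p e1] extends
   [w]. *)
have [|e eP] := @pairing_liftr _ _ _ _ _ bP0 _ _ p1 (w0' - hom_then j g0).
  move=> r; apply/(tau_exact tauX); rewrite homBE linearB g0P.
  apply/eqP; rewrite subr_eq0; apply/eqP.
  apply: ModHomP => z; rewrite g'P -[LHS]thP; apply/subr0_eq.
  have [x xP] := gP z; have := tau_incl_ker x r.
  by rewrite xP -[LHS]/(th z (rho (j r)) - g z (j r)) rhoP.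
have [g1 g1P] := pairing_adjoint' g0 bS0 bP1.
have [e1 e1P] := pairing_adjoint' e bS1 bP0.
exists (hom_then e1 p) => v; rewrite /= -w0P.
have -> : w0 v = i (g1 v) + e1 (star_hom p1 v).
  apply: (pairing_injl bP0) => r; rewrite (pairingDl bP0) ij g1P e1P w0'P.
  rewrite -[X in _ + X]/(star_eval v (p1 (e r))) eP homBE /= -(pairingDr bS0).
  by rewrite addrC subrK.
by rewrite linearD pi add0r.
Qed.

End Translate.
End TauTranslate.

(** * Preprojective modules and supports *)

Section Preprojective.
Variables (k : fieldType) (A : falgType k).
Hypothesis hher : hereditary_algebra A.
Implicit Types (X Z M P : lmodType A).

Definition hom_and_ext X M : Prop :=
  (exists (u : ModHom X M) x, u x <> 0) /\
  (exists d : A -> X -> M, cocycle d /\ ~ coboundary d).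

Lemma tau_inv_hom_and_ext Z X M :
  fin_dim Z -> is_tau_inv Z X -> fin_dim M -> indecomposable M ->
  hom_and_ext X M ->
  exists N : lmodType A, [/\ fin_dim N, indecomposable N & hom_and_ext Z N].
Proof.
move=> fdZ ZX fdM indM [[u [x ux]] [d [dZ dB]]].
have [P1 [P0 [p1 [p0 [q tauX]]]]] := is_tau_inv_presentation hher fdZ ZX.
(* The idempotent [e] with the kernel of [f] is 0 or 1. If it is 1, [f] is injective, and [f u = 0],
   from Hom(X, A) = 0, forces [u = 0]. *)
have hom0 (f : ModHom M A^o) y : f y = 0.
  have [e [fe ke]] :=
    split_image hher f (regular_fin_dim A) (@regular_projective A).
  have ee t : e (e t) = e t.
    by apply/subr0_eq; rewrite -linearB; apply: ke; rewrite linearB fe subrr.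
  case: (indecomposable_idempotent indM ee) => H; first by rewrite -fe H linear0.
  case: ux; rewrite -[LHS]H; apply: ke.
  exact: (tau_inv_hom0 tauX (hom_then u f)).
have [n [e eP]] := fin_dim_spanned fdM.
pose Q0 : lmodType A := {ffun 'I_n -> A^o}; pose p : ModHom Q0 M := free_hom e.
have pO : onto p.
  move=> y; have [c ->] := eP y; exists [ffun l => c l].
  by apply: eq_bigr => l _; rewrite ffunE.
(* The kernel of a free cover is projective by heredity, so [M] has a resolution of length one. *)
pose Q1 : lmodType A := submod (ker_submodule p).
pose i : ModHom Q1 Q0 := submod_incl (ker_submodule p).
have iI : injective i by apply: submod_incl_inj.
have bP0 := free_pairing A n; have fdQ0 := pairing_fdl bP0.
have projQ1 : projective_module Q1.
  exact: hher fdQ0 (@free_projective A n) iI.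
have [m spanQ1] := fin_dim_spanned (fin_dim_inj iI fdQ0).
have bP1 := lstar_pairing projQ1 spanQ1.
have ip y : p y = 0 <-> exists t, i t = y.
  split; first by move=> py; apply: submod_incl_onto.
  by move=> [t <-]; apply: (submod_inclP t).
have [j ij] := pairing_adjoint i bP1 bP0.
have [f [z fz]] := hom_tau bP0 bP1 pO ip ij tauX ux.
exists (tau j); split; first exact: (tau_fin_dim j bP1).
  apply: (tau_indecomposable bP0 bP1 iI pO ip ij hom0 indM) => tau0.
  by apply: fz; apply: tau0.
split; first by exists f, z.
exact: (ext_tau bP0 bP1 pO ip ij hom0 tauX dZ dB).
Qed.

Lemma mod_iso_projective P X :
  mod_iso P X -> projective_module P -> projective_module X.
Proof.
move=> [f [g fK gK]] projP Y W h t hO.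
have fO : onto f by move=> x; exists (g x).
have [|g' g'P] := factor_onto (f := hom_id P) fO.
  by move=> u fu; apply: (can_inj fK); rewrite fu linear0.
have [l lP] := projP _ _ h (hom_then f t) hO.
exists (hom_then g' l) => x; rewrite [LHS]lP /=.
by have [u <-] := fO x; rewrite g'P.
Qed.

Lemma tau_inv_fin_dim Z X : fin_dim Z -> is_tau_inv Z X -> fin_dim X.
Proof.
move=> fdZ /(is_tau_inv_presentation hher fdZ)[P1 [P0 [p1 [p0 [q tauX]]]]].
exact: fin_dim_onto (tau_inv_onto tauX) (pairing_fdl (tau_pairing1 tauX)).
Qed.

Lemma tau_inv_iter_fin_dim m P X :
  fin_dim P -> is_tau_inv_iter m P X -> fin_dim X.
Proof.
move=> fdP; elim: m X => [|m IH] X /=.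
  by move=> [f [g fK gK]]; apply: (fin_dim_onto (f := f)) => // x; exists (g x).
by move=> [Z [/IH fdZ]]; apply: tau_inv_fin_dim.
Qed.

Lemma preprojective_not_hom_and_ext m P X M :
  fin_dim P -> projective_module P -> is_tau_inv_iter m P X ->
  fin_dim M -> indecomposable M -> ~ hom_and_ext X M.
Proof.
move=> fdP projP; elim: m X M => [|m IH] X M /=.
  move=> PX _ _ [_ [d [dZ]]]; apply.
  exact: projective_coboundary dZ (mod_iso_projective PX projP).
move=> [Z [PZ ZX]] fdM indM XM.
have [N [fdN indN ZN]] :=
  tau_inv_hom_and_ext (tau_inv_iter_fin_dim fdP PZ) ZX fdM indM XM.
exact: IH PZ fdN indN ZN.
Qed.

End Preprojective.

Section Supports.
Variables (k : fieldType) (A : falgType k) (T : lmodType A).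

(** Induction on dimension: if [X] decomposes, its idempotent is the sum of those of the two
    factors, so one of them does not kill [s]. *)
Lemma indecomposable_summand_act (S : lmodType (ModEnd T)) (n : nat)
    (X : lmodType A) (i : ModHom X T) (p : ModHom T X) (s : S) :
  spanned (restrict X) n -> (forall x, p (i x) = x) ->
  (hom_then p i : ModEnd T) *: s <> 0 ->
  exists (Y : lmodType A) (i' : ModHom Y T) (p' : ModHom T Y),
    [/\ forall y, p' (i' y) = y, indecomposable Y
      & (hom_then p' i' : ModEnd T) *: s <> 0].
Proof.
elim: n X i p => [|n IH] X i p fdX pi es.
  case: es; suff -> : (hom_then p i : ModEnd T) = 0 by rewrite scale0r.
  apply: ModHomP => t; have [e eP] := fdX.
  by have [c H] := eP (p t); rewrite /= H big_ord0 linear0.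
have [indX|nindX] := pselect (indecomposable X); first by exists X, i, p.
(* A nonzero kernel vector of the projection [r] makes the factor [Y] smaller than [X]. *)
have step (Y : lmodType A) (r : ModHom X Y) (l : ModHom Y X) :
    (forall y, r (l y) = y) -> (exists2 x, x <> 0 & r x = 0) ->
    (hom_then (hom_then p r) (hom_then l i) : ModEnd T) *: s <> 0 ->
    exists (Y : lmodType A) (i' : ModHom Y T) (p' : ModHom T Y),
    [/\ forall y, p' (i' y) = y, indecomposable Y
      & (hom_then p' i' : ModEnd T) *: s <> 0].
  move=> rl [x x0 rx]; apply: IH => [|y]; last by rewrite /= pi rl.
  apply: (@spanned_onto_drop _ (restrict X) (restrict Y)
    (lin_hom (res_linear r)) n x _ fdX x0 rx).
  by move=> y; exists (l y); apply: rl.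
apply: contrapT => nind; apply: nindX; split.
  move=> X0; apply: es; suff -> : (hom_then p i : ModEnd T) = 0 by rewrite scale0r.
  by apply: ModHomP => t; rewrite /= (X0 (p t)) linear0.
move=> Y Y' [f [g fK gK]].
have gL : linear g by move=> a u v; apply: (can_inj fK); rewrite linearP !gK.
have g0 : g 0 = 0 by apply: (can_inj fK); rewrite gK linear0.
have r1L : linear (fun x => (f x).1) by move=> a u v; rewrite linearP.
have r2L : linear (fun x => (f x).2) by move=> a u v; rewrite linearP.
have l1L : linear (fun y => g (y, 0)).
  by move=> a u v; rewrite -gL; congr (g (_, _)); rewrite /= scaler0 addr0.
have l2L : linear (fun y => g (0, y)).
  by move=> a u v; rewrite -gL; congr (g (_, _)); rewrite /= scaler0 addr0.
apply: contrapT => /not_orP[/existsNP[y y0] /existsNP[y' y'0]].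
pose e1 : ModEnd T := hom_then (hom_then p (lin_hom r1L)) (hom_then (lin_hom l1L) i).
pose e2 : ModEnd T := hom_then (hom_then p (lin_hom r2L)) (hom_then (lin_hom l2L) i).
have e12 : (hom_then p i : ModEnd T) = e1 + e2.
  apply: ModHomP => t; rewrite -[RHS]/(i (g ((f (p t)).1, 0)) + i (g (0, (f (p t)).2))).
  rewrite -linearD -[X in i (X + _)]scale1r -gL scale1r /=.
  congr (i _); rewrite -[LHS]fK; congr (g _).
  by case: (f (p t)) => a b; congr (_, _); rewrite /= ?addr0 ?add0r.
apply: es; rewrite e12 scalerDl.
have -> : e1 *: s = 0.
  apply: contrapT => H; apply: nind; apply: step H => [z|/=]; first by rewrite /= gK.
  exists (g (0, y')); last by rewrite gK.
  by move=> /(congr1 f); rewrite gK linear0 => -[].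
rewrite add0r; apply: contrapT => H.
apply: nind; apply: step H => [z|/=]; first by rewrite /= gK.
exists (g (y, 0)); last by rewrite gK.
by move=> /(congr1 f); rewrite gK linear0 => -[].
Qed.

Lemma hom_act_restrict (M X : lmodType A) (i : ModHom X T) (p : ModHom T X)
    (g : ModHom T M) :
  (hom_then p i : ModEnd T) *: g <> 0 -> exists (u : ModHom X M) x, u x <> 0.
Proof.
move=> pig; exists (hom_then i g); apply: contrapT => /forallNP u0; apply: pig.
by apply: ModHomP => t; apply: contrapT; apply: (u0 (p t)).
Qed.

(** The cocycle is pulled back along [i]; if [h] bounded it, [h p] would bound the cocycle
    representing the product. *)
Lemma ext_act_restrict (M X : lmodType A) (i : ModHom X T) (p : ModHom T X)
    (e : Ext1 T M) :
  (hom_then p i : ModEnd T) *: e <> 0 ->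
  exists d : A -> X -> M, cocycle d /\ ~ coboundary d.
Proof.
move=> pie; pose c : Cocycle T M := repr e.
have /asboolP[cX cA cM] := valP c.
exists (fun a x => val c a (i x)); split.
  split=> [a b x y|x|a b x]; last 1 first.
  - by rewrite cM linearZ.
  - by rewrite -cX; congr (val c a _); exact: (linearP (i : ModHom _ _)).
  - exact: cA.
move=> [h hP]; apply: pie.
rewrite -[e]ext_classK -[_ *: _]/(ext_scale _ _) ext_scaleE.
have <- : ext_class (0 : Cocycle T M) = 0.
  by apply: (addIr (ext_class 0)); rewrite add0r -ext_classD addr0.
apply/ext_classP; rewrite subr0; apply/asboolP.
have hL : linear ((fun t => h (p t)) : restrict T -> restrict M).
  by move=> a t u; rewrite [p _](linearP (lin_hom (res_linear p))) [LHS]linearP.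
exists (lin_hom hL) => a t.
rewrite -[LHS]/(val c a (i (p t))) hP.
by rewrite -[lin_hom hL (a *: t)]/(h (p (a *: t))) [p (a *: t)]linearZ.
Qed.

End Supports.

Theorem mainTheorem4 (k : closedFieldType) (A : falgType k)
  (hconn : connected_algebra A) (hher : hereditary_algebra A)
  (T : lmodType A) (hT : fin_dim T) (htilt : tilting_module T)
  (hprep : preprojective_module T)
  (M : lmodType A) (hM : fin_dim M) (hind : indecomposable M) :
  disjoint_supports (Ext1 T M : lmodType (ModEnd T))
                    (ModHom T M : lmodType (ModEnd T)).
Proof.
move=> S [[[S0 _] extS] [_ homS]]; have [n fdT] := hT.
have [s s0] : exists s : S, s <> 0 by apply/existsNP.
(* The decomposition starts from [T] as a summand of itself, with idempotent 1. *)
have act_s : (hom_then (hom_id T) (hom_id T) : ModEnd T) *: s <> 0.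
  by have -> : (hom_then (hom_id T) (hom_id T) : ModEnd T) = 1;
    [exact: ModHomP | rewrite scale1r].
have [X [i [p [pi indX es]]]] :=
  indecomposable_summand_act (i := hom_id T) (p := hom_id T) fdT (fun=> erefl) act_s.
have [|P [m [fdP projP _ PX]]] := hprep X _ indX.
  by eexists; apply: split_summand pi.
(* The idempotent of [X] acts nontrivially on [S], hence on both modules having [S] as a composition
   factor. *)
apply: (preprojective_not_hom_and_ext hher fdP projP PX hM hind); split.
  have [g pig] := composition_factor_act homS es.
  exact: hom_act_restrict pig.
have [e pie] := composition_factor_act extS es.
exact: ext_act_restrict pie.
Qed.
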